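(* Let $\mathcal{H}$ be a complex Hilbert space. Let $T=(T_{ij})$ be an $n\times n$ operator matrix, where $T_{ij}\in\mathcal{B}(\mathcal{H})$. Let $f$ and $g$ be two non-negative continuous functions on $[0,\infty)$ such that $f(t)g(t)=t$ for all $t\ge0$. Then $$w(T)\le\min_{0\le\alpha\le1}\sqrt{\left\|\alpha|R|^2+(1-\alpha)|S|^2\right\|},$$ where $R=(r_{ij})_{n\times n}$ with $$r_{ij}=\begin{cases}\frac12\left\|f^2(|T_{ii}|)+g^2(|T_{ii}^*|)\right\| & \text{if } i=j,\\ \frac12\left(\|f^2(|T_{ij}|)\|^{\frac12}\|g^2(|T_{ij}^*|)\|^{\frac12}+\|f^2(|T_{ji}|)\|^{\frac12}\|g^2(|T_{ji}^*|)\|^{\frac12}\right) & \text{if } i\ne j,\end{cases}$$ and $S=(s_{ij})_{n\times n}$ with $s_{ij}=\|T_{ij}\|$.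
   Context: $\mathcal{B}(\mathcal{H})$ is the space of bounded linear operators on $\mathcal{H}$, and $\|\cdot\|$ is the usual operator norm. An $n\times n$ operator matrix $T=(T_{ij})$ acts on the Hilbert space direct sum $\oplus_{i=1}^n\mathcal{H}$ by $(Tx)_i=\sum_{j}T_{ij}x_j$. For a bounded operator $T$ on a complex Hilbert space $\mathcal{K}$: the numerical radius is $w(T)=\sup\{|\langle Tx,x\rangle|:x\in\mathcal{K},\ \|x\|=1\}$, and $|T|=(T^*T)^{1/2}$. Expressions $f^2(|T|)=(f(|T|))^2$ and $g^2(|T^*|)=(g(|T^*|))^2$ are understood via the continuous functional calculus. Scalar $n\times n$ matrices (such as $R,S$) are regarded as operators on $\mathbb{C}^n$ with the standard inner product. *)

(* Defs.v *)
From HB Require Import structures.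
From mathcomp Require Import all_boot all_order all_algebra.
From mathcomp Require Import complex.
From mathcomp Require Import all_classical all_reals all_analysis.

Set Implicit Arguments.
Unset Strict Implicit.
Unset Printing Implicit Defensive.

Import Order.TTheory GRing.Theory Num.Theory.
Import numFieldNormedType.Exports.

Local Open Scope classical_set_scope.
Local Open Scope ring_scope.
Local Open Scope complex_scope.

(* The form is linear in the first argument, conjugate-linear in the second. *)
HB.mixin Record CompleteNormedModule_isHilbert (R : realType) V
    of CompleteNormedModule R[i] V := {
  hdot : {dot V for @Num.conj R[i]};
  hdot_norm : forall x : V, hdot x x = `|x| ^+ 2
}.

#[short(type="hilbertType")]
HB.structure Definition Hilbert (R : realType) :=
  {V of CompleteNormedModule R[i] V & CompleteNormedModule_isHilbert R V}.

(* Norms and moduli live in R[i]; Re brings them back to R without loss. *)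
Definition rnorm (R : realType) (V : normedModType R[i]) (x : V) : R :=
  complex.Re `|x|.

Section dot_norm.
Variables (C : numClosedFieldType) (U : lmodType C).
Variable form : {dot U for @Num.conj C}.

Definition dot_norm (u : U) : C := sqrtC (form u u).

Lemma dot_norm_sqr u : dot_norm u ^+ 2 = form u u.
Proof. by rewrite /dot_norm sqrtCK. Qed.

Lemma dot_norm_ge0 u : 0 <= dot_norm u.
Proof. exact: sqrt_dnorm_ge0. Qed.

Lemma dot_norm_eq0 u : dot_norm u = 0 -> u = 0.
Proof. by move=> /eqP; rewrite sqrt_dnorm_eq0 => /eqP. Qed.

Lemma dot_normZ a u : dot_norm (a *: u) = `|a| * dot_norm u.
Proof.
rewrite /dot_norm dnormZ sqrtCM ?nnegrE ?exprn_ge0 ?dnorm_ge0//.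
by rewrite sqrCK.
Qed.

Lemma dot_CS u v : `|form u v| <= dot_norm u * dot_norm v.
Proof.
have [->|v0] := eqVneq v 0.
  by rewrite linear0r normr0 mulr_ge0// dot_norm_ge0.
have vv_gt0 : 0 < form v v by rewrite dnorm_gt0.
rewrite -(@ler_pXn2r _ 2)// ?nnegrE ?mulr_ge0 ?dot_norm_ge0//.
rewrite exprMn !dot_norm_sqr.
have [a aE] : exists a, form u v = a * form v v.
  by exists (form u v / form v v); rewrite divfK// gt_eqF.
have := dnorm_ge0 form (u - a *: v).
rewrite dnormB dnormZ linearZr_LR /= aE.
have vvC : (form v v)^*%R = form v v by apply: CrealP; rewrite gtr0_real.
rewrite !rmorphM /= conjCK vvC normrM (gtr0_norm vv_gt0).
rewrite !mulrA -[_^*%R * a]mulrC -normCK => h.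
rewrite exprMn [_ ^+ 2 in leLHS]expr2 [in leLHS]mulrA ler_pM2r//.
by move: h; rewrite opprD addrA addrK subr_ge0.
Qed.

Lemma dot_normD u v : dot_norm (u + v) <= dot_norm u + dot_norm v.
Proof.
rewrite -(@ler_pXn2r _ 2)// ?nnegrE ?addr_ge0 ?dot_norm_ge0//.
rewrite dot_norm_sqr dnormD sqrrD !dot_norm_sqr.
rewrite [leRHS]addrAC lerD2l.
set z := form u v.
apply: (@le_trans _ _ (`|z| *+ 2)); last by rewrite lerMn2r dot_CS orbT.
have zr : z + z^*%R \is Num.real.
  by rewrite CrealE rmorphD /= conjCK addrC.
apply: le_trans (real_ler_norm zr) _.
by apply: le_trans (ler_normD _ _) _; rewrite norm_conjC mulr2n.
Qed.

End dot_norm.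

Section complex_hilbert.
Variable R : realType.

(* The instances go on R[i] and not on R[i]^o, because the library reserves
   the complete structure of T^o to T : realType. *)
HB.instance Definition _ := NormedModule.copy R[i] R[i]^o.

Lemma Re_norm_le (z : R[i]) : `|complex.Re z|%:C <= `|z|.
Proof.
case: z => a b /=; rewrite lecE /= eqxx /=.
by rewrite -sqrtr_sqr ler_sqrt ?lerDl ?addr_ge0 ?sqr_ge0.
Qed.

Lemma Im_norm_le (z : R[i]) : `|complex.Im z|%:C <= `|z|.
Proof.
case: z => a b /=; rewrite lecE /= eqxx /=.
by rewrite -sqrtr_sqr ler_sqrt ?lerDr ?addr_ge0 ?sqr_ge0.
Qed.

Lemma norm_le_ReIm (z : R[i]) :
  `|z| <= (`|complex.Re z| + `|complex.Im z|)%:C.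
Proof.
rewrite [in leLHS](complexE z) (le_trans (ler_normD _ _))// rmorphD lerD//.
  by rewrite normc_def /= expr0n addr0 sqrtr_sqr.
by rewrite normrM !normc_def /= !expr0n /= add0r expr1n sqrtr1 addr0 sqrtr_sqr mul1r.
Qed.

Lemma complex_complete (F : set_system R[i]) :
  ProperFilter F -> cauchy F -> cvg F.
Proof.
move=> FF /cauchyP Fc.
have ReB : {morph @complex.Re R : x y / x - y} by move=> [? ?] [? ?].
have ImB : {morph @complex.Im R : x y / x - y} by move=> [? ?] [? ?].
have cvgP (g : R[i] -> R) : {morph g : x y / x - y} ->
    (forall z, `|g z|%:C <= `|z|) -> exists l : R, g @ F --> l.
  move=> gB gle; apply/cvg_ex; apply: R_complete; apply/cauchyP => e e0.
  have [x Fx] : exists x, F (ball x (e%:C : R[i])) by apply: Fc; rewrite ltcR.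
  exists (g x); suff: F (g @^-1` ball (g x) e) by []; apply: filterS Fx => y; rewrite -!ball_normE /= => xy.
  by rewrite -gB -ltcR; apply: le_lt_trans (gle _) xy.
have [a Fa] := cvgP (@complex.Re R) ReB Re_norm_le.
have [b Fb] := cvgP (@complex.Im R) ImB Im_norm_le.
apply/cvg_ex; exists (a +i* b : R[i]).
apply/cvgrPdist_lt => e e0.
have eE : e = (complex.Re e)%:C.
  by move: e0; rewrite ltcE /= => /andP[/eqP ei _]; case: e ei => ? ? /= ->.
rewrite eE in e0 *; rewrite ltcR in e0.
set r := complex.Re e in e0 *.
have r2 : 0 < r / 2 by rewrite divr_gt0.
move/cvgrPdist_lt: Fa => /(_ _ r2) Fa.
move/cvgrPdist_lt: Fb => /(_ _ r2) Fb.
near=> z.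
apply: le_lt_trans (norm_le_ReIm _) _.
rewrite ltcR [ltRHS](splitr r) ReB ImB.
rewrite ltrD//=; [by near: z|by near: z].
Unshelve. all: by end_near. Qed.

HB.instance Definition _ := Uniform_isComplete.Build R[i] complex_complete.

Definition complex_dot (x y : R[i]) : R[i] := x * y^*%R.

Lemma complex_dot_bilinear :
  bilinear_for (GRing.Scale.Law.clone _ _ *%R _)
    (GRing.Scale.Law.clone _ _ (@Num.conj R[i] \; *%R) _) complex_dot.
Proof.
rewrite /complex_dot; split=> [v|u] a x y /=; first by rewrite mulrDl -mulrA.
by rewrite rmorphD rmorphM /= mulrDr mulrCA.
Qed.

HB.instance Definition _ :=
  bilinear_isBilinear.Build _ _ _ _ _ _ complex_dot complex_dot_bilinear.

Lemma complex_dot_herm x y :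
  complex_dot x y = (-1) ^+ false * (complex_dot y x)^*%R.
Proof. by rewrite /complex_dot mul1r rmorphM /= conjCK mulrC. Qed.

HB.instance Definition _ :=
  isHermitianSesquilinear.Build _ _ _ _ complex_dot complex_dot_herm.

Lemma complex_dot_gt0 x : x != 0 -> 0 < complex_dot x x.
Proof. by move=> x0; rewrite /complex_dot -normCK exprn_gt0// normr_gt0. Qed.

HB.instance Definition _ := isDotProduct.Build _ _ complex_dot complex_dot_gt0.

Lemma complex_dot_norm x :
  (complex_dot : {dot R[i] for @Num.conj R[i]}) x x = `|x| ^+ 2.
Proof. by rewrite /= /complex_dot -normCK. Qed.

HB.instance Definition _ :=
  CompleteNormedModule_isHilbert.Build R R[i] complex_dot_norm.

End complex_hilbert.

(* The Hilbert space direct sum of n copies of H. *)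
Definition hsum (R : realType) (H : hilbertType R) (n : nat) : Type :=
  {ffun 'I_n -> H}.

Section hsum_hilbert.
Variables (R : realType) (H : hilbertType R) (n : nat).

HB.instance Definition _ := GRing.Lmodule.copy (hsum H n) {ffun 'I_n -> H}.

Definition hsum_dot (x y : hsum H n) : R[i] := \sum_(i < n) hdot (x i) (y i).

Lemma hsum_dot_bilinear :
  bilinear_for (GRing.Scale.Law.clone _ _ *%R _)
    (GRing.Scale.Law.clone _ _ (@Num.conj R[i] \; *%R) _) hsum_dot.
Proof.
rewrite /hsum_dot; split=> [v|u] a x y /=; rewrite mulr_sumr -big_split /=.
  by apply: eq_bigr => i _; rewrite !ffunE linearPl.
by apply: eq_bigr => i _; rewrite !ffunE linearPr.
Qed.

HB.instance Definition _ :=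
  bilinear_isBilinear.Build _ _ _ _ _ _ hsum_dot hsum_dot_bilinear.

Lemma hsum_dot_herm x y : hsum_dot x y = (-1) ^+ false * (hsum_dot y x)^*%R.
Proof.
rewrite mul1r /hsum_dot rmorph_sum /=.
by apply: eq_bigr => i _; rewrite [LHS]hermC /= mul1r.
Qed.

HB.instance Definition _ :=
  isHermitianSesquilinear.Build _ _ _ _ hsum_dot hsum_dot_herm.

Lemma hsum_dotxx (x : hsum H n) : hsum_dot x x = \sum_(i < n) `|x i| ^+ 2.
Proof. by apply: eq_bigr => i _; rewrite hdot_norm. Qed.

Lemma hsum_dot_gt0 x : x != 0 -> 0 < hsum_dot x x.
Proof.
move=> x0; have [i xi] : exists i, x i != 0.
  apply/existsP; apply: contraNT x0 => /existsPn x0.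
  by apply/eqP/ffunP => i; rewrite !ffunE; apply/eqP; have := x0 i; rewrite negbK.
rewrite hsum_dotxx (bigD1 i)//= ltr_wpDr ?exprn_gt0 ?normr_gt0//.
by apply: sumr_ge0 => j _; rewrite exprn_ge0.
Qed.

HB.instance Definition _ := isDotProduct.Build _ _ hsum_dot hsum_dot_gt0.

HB.instance Definition _ := @Lmodule_isNormed.Build R[i] (hsum H n)
  (dot_norm hsum_dot) (dot_normD hsum_dot) (dot_normZ hsum_dot)
  (@dot_norm_eq0 _ _ hsum_dot).

Lemma hsum_normE (x : hsum H n) : `|x| = sqrtC (\sum_(i < n) `|x i| ^+ 2).
Proof. by rewrite -hsum_dotxx. Qed.

Lemma hsum_norm_coord (x : hsum H n) i : `|x i| <= `|x|.
Proof.
rewrite -(@ler_pXn2r _ 2)// ?nnegrE// hsum_normE sqrtCK.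
rewrite (bigD1 i)//= lerDl.
by apply: sumr_ge0 => j _; rewrite exprn_ge0.
Qed.

Lemma hsum_norm_sum (x : hsum H n) : `|x| <= \sum_(i < n) `|x i|.
Proof.
have s0 : 0 <= \sum_(i < n) `|x i| by apply: sumr_ge0.
rewrite -(@ler_pXn2r _ 2)// ?nnegrE// hsum_normE sqrtCK.
rewrite [leRHS]expr2 mulr_suml; apply: ler_sum => i _.
by rewrite expr2 ler_wpM2l// (bigD1 i)//= lerDl sumr_ge0.
Qed.

Lemma hsum_complete (F : set_system (hsum H n)) :
  ProperFilter F -> cauchy F -> cvg F.
Proof.
move=> FF /cauchyP Fc.
have cvgP i : exists l : H, (fun x : hsum H n => x i) @ F --> l.
  apply/cvg_ex; apply: cauchy_cvg; apply/cauchyP => e e0.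
  have [x Fx] := Fc _ e0.
  exists (x i).
  suff: F ((fun x : hsum H n => x i) @^-1` ball (x i) e) by [].
  apply: filterS Fx => y; rewrite -!ball_normE /=; apply: le_lt_trans.
  by have := hsum_norm_coord (x - y) i; rewrite !ffunE.
have [l Fl] := choice cvgP.
apply/cvg_ex; exists ([ffun i => l i] : hsum H n).
apply/cvgrPdist_lt => e e0.
pose d := e / n.+1%:R.
have d0 : 0 < d by rewrite divr_gt0.
have Fd : \forall z \near F, forall i, `|l i - (z : hsum H n) i| < d.
  by apply: filter_forall => i; move/cvgrPdist_lt: (Fl i); exact.
near=> z.
apply: le_lt_trans (hsum_norm_sum _) _.
apply: (@le_lt_trans _ _ (\sum_(i < n) d)).
  apply: ler_sum => i _; rewrite !ffunE.
  by apply/ltW; move: i; near: z.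
rewrite sumr_const card_ord -[d *+ n]mulr_natr /d mulrAC ltr_pdivrMr//.
by rewrite ltr_pM2l// ltr_nat.
Unshelve. all: by end_near. Qed.

HB.instance Definition _ := Uniform_isComplete.Build (hsum H n) hsum_complete.

Lemma hsum_dot_norm (x : hsum H n) :
  (hsum_dot : {dot hsum H n for @Num.conj R[i]}) x x = `|x| ^+ 2.
Proof. by rewrite hsum_normE sqrtCK -hsum_dotxx. Qed.

HB.instance Definition _ :=
  CompleteNormedModule_isHilbert.Build R (hsum H n) hsum_dot_norm.

End hsum_hilbert.

Section operators.
Variable R : realType.
Implicit Types V W : hilbertType R.

Definition bounded_op V W (T : V -> W) : Prop :=
  linear T /\ bounded_near T (nbhs (0 : V)).

(* sup is real-valued with sup set0 = 0 and junk value 0 on unbounded sets;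
   both suprema below are of bounded sets when T is a bounded operator, and
   the second one is over the empty set exactly when V is trivial. *)
Definition opnorm V W (T : V -> W) : R :=
  sup [set rnorm (T x) | x in [set x : V | `|x| <= 1]].

Definition numradius V (T : V -> V) : R :=
  sup [set rnorm (hdot (T x) x) | x in [set x : V | `|x| = 1]].

Definition adjoint V (T : V -> V) : V -> V :=
  get [set S : V -> V |
    bounded_op S /\ forall x y, hdot (T x) y = hdot x (S y)].

Definition spectrum V (T : V -> V) : set R[i] :=
  [set l | ~ exists S : V -> V,
    [/\ bounded_op S, cancel S (fun x => T x - l *: x)
      & cancel (fun x => T x - l *: x) S]].

Definition poly_op V (p : {poly R}) (T : V -> V) : V -> V :=
  fun x => \sum_(k < size p) (p`_k)%:C *: iter k T x.

(* Continuous functional calculus f(T), for T self-adjoint (so that the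
   spectrum is real) and f continuous on the spectrum of T: the norm limit of
   p_k(T) for real polynomials p_k converging to f uniformly on the spectrum.
   The values of f outside the spectrum are irrelevant. *)
Definition cfc V (f : R -> R) (T : V -> V) : V -> V :=
  get [set S : V -> V | bounded_op S /\
    exists p : nat -> {poly R},
      {uniform [set t | spectrum T t%:C],
        (fun k t => (p k).[t]) @ \oo --> f} /\
      opnorm (poly_op (p k) T \- S) @[k --> \oo] --> (0 : R)].

(* |T| = (T^* T)^(1/2) *)
Definition absop V (T : V -> V) : V -> V :=
  cfc (@Num.sqrt R) (adjoint T \o T).

Definition sqop V (T : V -> V) : V -> V := T \o T.

Definition opmx V n (T : 'I_n -> 'I_n -> V -> V) (x : hsum V n) : hsum V n :=
  [ffun i => \sum_(j < n) T i j (x j)].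

(* A scalar matrix as an operator on C^n = hsum R[i] n, whose inner product
   is the standard one. *)
Definition mxop n (A : 'M[R[i]]_n) : hsum R[i] n -> hsum R[i] n :=
  opmx (fun i j (z : R[i]) => A i j * z).

(* f^2(|T|) *)
Definition sq_cfc_abs V (f : R -> R) (T : V -> V) : V -> V :=
  sqop (cfc f (absop T)).

Definition matR V n (T : 'I_n -> 'I_n -> V -> V) (f g : R -> R) : 'M[R[i]]_n :=
  let normF i j := opnorm (sq_cfc_abs f (T i j)) in
  let normG i j := opnorm (sq_cfc_abs g (adjoint (T i j))) in
  \matrix_(i, j)
    (if i == j then
       2^-1 * opnorm (sq_cfc_abs f (T i i) \+ sq_cfc_abs g (adjoint (T i i)))
     else
       2^-1 * (Num.sqrt (normF i j) * Num.sqrt (normG i j)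
               + Num.sqrt (normF j i) * Num.sqrt (normG j i)))%:C.

Definition matS V n (T : 'I_n -> 'I_n -> V -> V) : 'M[R[i]]_n :=
  \matrix_(i, j) (opnorm (T i j))%:C.

Definition is_minimum (A : set R) (m : R) : Prop := A m /\ lbound A m.

End operators.

(* Main.v *)
Require Import Defs.
From HB Require Import structures.
From mathcomp Require Import all_boot all_order all_algebra.
From mathcomp Require Import complex ring lra.
From mathcomp Require Import all_classical all_reals all_analysis.

Set Implicit Arguments.
Unset Strict Implicit.
Unset Printing Implicit Defensive.

Import Order.TTheory GRing.Theory Num.Theory.
Import numFieldNormedType.Exports.

Local Open Scope classical_set_scope.
Local Open Scope ring_scope.
Local Open Scope complex_scope.

(** Fix a unit vector [x] of the direct sum and let [u] be the vector of the
    norms of its coordinates, again a unit vector, in [C^n]. The matrices [R]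
    and [S] are designed so that both [|<Tx, x>| <= <Ru, u>] and
    [|<Tx, x>| <= <Su, u>] hold ([hdot_opmx_le_matR] and [hdot_opmx_le_matS]).
    Hence [|<Tx, x>|^2] is at most [|Ru|^2] and [|Su|^2], that is, at most
    [<|R|^2 u, u>] and [<|S|^2 u, u>], and therefore at most the norm of every
    convex combination of [|R|^2] and [|S|^2]. That norm is Lipschitz in the
    weight, so its minimum over [0, 1] is attained.

    The bound by [S] is the Cauchy-Schwarz inequality. The bound by [R] applies
    to each entry Kittaneh's mixed Schwarz inequality
    [|<Tx, y>| <= |f(|T|) x| |g(|T^*|) y|] ([mixed_schwarz]), followed by the
    arithmetic-geometric inequality on the diagonal and by a symmetrisation of
    the quadratic form off it.

    The mixed Schwarz inequality needs a functional calculus. Its foundation is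
    [poly_spectral_bound]: for self-adjoint [A], the norm of [q(A)] is at most
    the supremum of [|q|] on the spectrum of [A]. With [B = q(A)] and [M] the
    norm of [B], the operator [B^2 - M^2] is not bounded below; it is a
    polynomial in [A], so it splits into factors [A - z], one of which is not
    bounded below. Such a [z] is in the spectrum, is real, and satisfies
    [|q(z)| = M]. Together with the Weierstrass theorem ([weierstrass]) this
    makes [f(A)] exist for continuous [f] and positive [A], depend only on the
    values of [f] on the spectrum, and be multiplicative and monotone in [f].

    Everything is done with the real part [rdot] of the inner product; complex
    moduli are recovered at the end by rotating a vector ([hdot_le]). The only
    existence theorem on Hilbert spaces is [coercive_riesz], which gives
    adjoints as well as inverses of operators that are bounded below. *)

(** * Hilbert spaces as real inner product spaces *)

Section RealGeometry.
Context {R : realType}.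
Implicit Types V W : hilbertType R.

Definition rdot {V} (x y : V) : R := complex.Re (hdot x y).

Lemma normE V (x : V) : `|x| = (rnorm x)%:C.
Proof.
rewrite /rnorm; have := normr_ge0 x.
by case: (`|x|) => a b; rewrite lecE /= => /andP[/eqP -> _].
Qed.

Lemma rnorm_ge0 V (x : V) : 0 <= rnorm x.
Proof. by have := normr_ge0 x; rewrite normE lecR. Qed.

Lemma rnorm0 V : rnorm (0 : V) = 0.
Proof. by rewrite /rnorm normr0. Qed.

Lemma rnorm_eq0 V (x : V) : rnorm x = 0 -> x = 0.
Proof. by move=> x0; apply/eqP; rewrite -normr_eq0 normE x0. Qed.

Lemma rnormD V (x y : V) : rnorm (x + y) <= rnorm x + rnorm y.
Proof. by have := ler_normD x y; rewrite !normE -rmorphD /= lecR. Qed.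

Lemma rnorm_sum V n (F : 'I_n -> V) :
  rnorm (\sum_(i < n) F i) <= \sum_(i < n) rnorm (F i).
Proof.
elim/big_rec2: _ => [|i r u _ h]; first by rewrite rnorm0.
by apply: le_trans (rnormD _ _) _; rewrite lerD2l.
Qed.

Lemma rnormN V (x : V) : rnorm (- x) = rnorm x.
Proof. by rewrite /rnorm normrN. Qed.

Lemma rnormB V (x y : V) : rnorm (x - y) = rnorm (y - x).
Proof. by rewrite -opprB rnormN. Qed.

Lemma Re_norm_ge0 (a : R[i]) : 0 <= complex.Re `|a|.
Proof. by have := normr_ge0 a; case: (`|a|) => u v; rewrite lecE => /andP[]. Qed.

Lemma rnormZC V (a : R[i]) (x : V) : rnorm (a *: x) = complex.Re `|a| * rnorm x.
Proof.
rewrite /rnorm normrZ (normE x).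
by case: (`|a|) => u v /=; rewrite mulr0 subr0.
Qed.

Lemma rnormZ V (a : R) (x : V) : rnorm (a%:C *: x) = `|a| * rnorm x.
Proof. by rewrite rnormZC normc_def /= expr0n addr0 sqrtr_sqr. Qed.

Lemma hdotDl V (x y z : V) : hdot (x + y) z = hdot x z + hdot y z.
Proof. exact: linearDl. Qed.
Lemma hdotDr V (x y z : V) : hdot z (x + y) = hdot z x + hdot z y.
Proof. exact: linearDr. Qed.
Lemma hdotZl V a (x z : V) : hdot (a *: x) z = a * hdot x z.
Proof. exact: linearZl_LR. Qed.
Lemma hdotZr V a (x z : V) : hdot z (a *: x) = a^*%R * hdot z x.
Proof. exact: linearZr_LR. Qed.
Lemma hdotC V (x y : V) : hdot x y = (hdot y x)^*%R.
Proof. by rewrite [LHS]hermC /= mul1r. Qed.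

Lemma ReD (a b : R[i]) : complex.Re (a + b) = complex.Re a + complex.Re b.
Proof. by case: a b => [? ?] [? ?]. Qed.

Lemma rdotC V (x y : V) : rdot x y = rdot y x.
Proof. by rewrite /rdot hdotC; case: (hdot y x). Qed.

Lemma rdotDl V (x y z : V) : rdot (x + y) z = rdot x z + rdot y z.
Proof. by rewrite /rdot hdotDl ReD. Qed.

Lemma rdotZl V (a : R) (x z : V) : rdot (a%:C *: x) z = a * rdot x z.
Proof. by rewrite /rdot hdotZl; case: (hdot _ _) => u v /=; rewrite mul0r subr0. Qed.

Lemma rdot0l V (z : V) : rdot 0 z = 0.
Proof. by rewrite /rdot linear0l. Qed.

Lemma rdotNl V (x z : V) : rdot (- x) z = - rdot x z.
Proof. by rewrite -scaleN1r -(rmorphN1 (@real_complex R)) rdotZl mulN1r. Qed.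

Lemma rdotBl V (x y z : V) : rdot (x - y) z = rdot x z - rdot y z.
Proof. by rewrite rdotDl rdotNl. Qed.

Lemma rdotDr V (x y z : V) : rdot z (x + y) = rdot z x + rdot z y.
Proof. by rewrite rdotC rdotDl !(rdotC z). Qed.

Lemma rdotZr V (a : R) (x z : V) : rdot z (a%:C *: x) = a * rdot z x.
Proof. by rewrite rdotC rdotZl (rdotC z). Qed.

Lemma rdotNr V (x z : V) : rdot z (- x) = - rdot z x.
Proof. by rewrite rdotC rdotNl (rdotC z). Qed.

Lemma rdotBr V (x y z : V) : rdot z (x - y) = rdot z x - rdot z y.
Proof. by rewrite rdotDr rdotNr. Qed.

Definition rdotE := (@rdotDl, @rdotDr, @rdotNl, @rdotNr, @rdotZl, @rdotZr).

Lemma rdotxx V (x : V) : rdot x x = rnorm x ^+ 2.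
Proof. by rewrite /rdot hdot_norm normE -rmorphXn. Qed.

Lemma hdot_real V (x : V) : hdot x x = (rdot x x)%:C.
Proof. by rewrite rdotxx hdot_norm normE -rmorphXn. Qed.

(** Multiplying a vector by the imaginary unit recovers the imaginary part of
    the inner product from the real one. *)
Lemma hdotE V (x y : V) : hdot x y = (rdot x y +i* - rdot ('i *: x) y)%C.
Proof.
by rewrite /rdot hdotZl; case: (hdot x y) => a b /=; congr (_ +i* _)%C; lra.
Qed.

Lemma hdot_ext V W (x y : V) (x' y' : W) :
  rdot x y = rdot x' y' -> rdot ('i *: x) y = rdot ('i *: x') y' ->
  hdot x y = hdot x' y'.
Proof. by move=> h1 h2; rewrite !hdotE h1 h2. Qed.

Lemma rdot_CS V (x y : V) : `|rdot x y| <= rnorm x * rnorm y.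
Proof.
have [x0|x0] := eqVneq (rnorm x) 0.
  have -> : x = 0 by exact: rnorm_eq0.
  by rewrite rdot0l normr0 mulr_ge0// rnorm_ge0.
have xp : 0 < rnorm x by rewrite lt0r x0 rnorm_ge0.
have xy : rdot x y ^+ 2 <= rnorm x ^+ 2 * rnorm y ^+ 2.
  have := sqr_ge0 (rnorm ((rnorm x ^+ 2)%:C *: y - (rdot x y)%:C *: x)).
  rewrite -[leRHS]rdotxx !rdotE !rdotxx (rdotC y x) => h.
  have x2 : 0 < rnorm x ^+ 2 by rewrite exprn_gt0.
  by rewrite -subr_ge0 -(pmulr_rge0 _ x2); move: h; congr (0 <= _); ring.
rewrite -(@ler_pXn2r _ 2)// ?nnegrE ?mulr_ge0 ?rnorm_ge0//.
by rewrite exprMn real_normK// num_real.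
Qed.

Lemma rdot_le V (x y : V) : rdot x y <= rnorm x * rnorm y.
Proof. exact: le_trans (ler_norm _) (rdot_CS _ _). Qed.

Lemma exists_phase (z : R[i]) :
  exists2 c : R[i], `|c| = 1 & c * z = `|z|.
Proof.
have [->|z0] := eqVneq z 0; first by exists 1; rewrite ?normr1// mulr0 normr0.
have nz0 : `|z| != 0 by rewrite normr_eq0.
exists (`|z| / z); first by rewrite normf_div normr_id divff.
by rewrite divfK.
Qed.

(** A rotation of one argument makes the inner product non-negative, so its
    modulus is controlled by the real parts over all rotations. *)
Lemma hdot_le V W (F : W -> V) x y (K : R) :
  (forall a u, F (a *: u) = a *: F u) ->
  (forall c : R[i], `|c| = 1 -> rdot (F (c *: x)) y <= K) ->
  rnorm (hdot (F x) y : R[i]) <= K.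
Proof.
move=> FZ h; have [c c1 cz] := exists_phase (hdot (F x) y).
have -> : rnorm (hdot (F x) y : R[i]) = rdot (F (c *: x)) y.
  by rewrite /rdot FZ hdotZl cz.
exact: h.
Qed.

Lemma rnorm_cvg V (u : nat -> V) :
  (forall e : R, 0 < e -> exists N : nat, forall m n : nat,
     (N <= m)%N -> (N <= n)%N -> rnorm (u m - u n) <= e) ->
  exists l : V, forall e : R, 0 < e -> exists N : nat, forall n : nat,
     (N <= n)%N -> rnorm (u n - l) <= e.
Proof.
move=> uC.
have cu : cauchy (u @ \oo).
  apply/cauchy_ballP => e e0.
  have eE : e = (complex.Re e)%:C.
    by move: e0; rewrite ltcE /= => /andP[/eqP ei _]; case: e ei => ? ? /= ->.
  rewrite eE in e0 *; rewrite ltcR in e0.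
  set r := complex.Re e in e0 *.
  have [|N hN] := uC (r / 2); first by rewrite divr_gt0.
  pose B := u @` [set n | (N <= n)%N].
  have uB : (u @ \oo) B by exists N => // n /= Nn; exists n.
  exists (B, B) => // -[_ _] [/= [m Nm <-] [n Nn <-]]; rewrite -ball_normE /=.
  rewrite normE ltcR; apply: le_lt_trans (hN _ _ Nm Nn) _.
  by rewrite ltr_pdivrMr// ltr_pMr// ltr1n.
have /cvg_ex[l /cvgrPdist_le ul] : cvg (u @ \oo) by exact: cauchy_cvg.
exists l => e e0.
have [|N _ hN] := ul (e%:C); first by rewrite ltcR.
by exists N => n /hN /=; rewrite rnormB normE lecR.
Qed.

End RealGeometry.

(** * Bounded operators and the operator norm *)

Section BoundedOperators.
Context {R : realType}.
Implicit Types V W U : hilbertType R.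

Lemma bopD V W (T : V -> W) : bounded_op T -> forall x y, T (x + y) = T x + T y.
Proof. by move=> [lT _] x y; have := lT 1 x y; rewrite !scale1r. Qed.

Lemma bop0 V W (T : V -> W) : bounded_op T -> T 0 = 0.
Proof. by move=> bT; apply: (addrI (T 0)); rewrite -bopD// !addr0. Qed.

Lemma bopZ V W (T : V -> W) : bounded_op T -> forall a x, T (a *: x) = a *: T x.
Proof.
by move=> bT a x; have := bT.1 a x 0; rewrite (bop0 bT) !addr0.
Qed.

Lemma bopN V W (T : V -> W) : bounded_op T -> forall x, T (- x) = - T x.
Proof. by move=> bT x; rewrite -scaleN1r bopZ// scaleN1r. Qed.

Lemma bopB V W (T : V -> W) : bounded_op T -> forall x y, T (x - y) = T x - T y.
Proof. by move=> bT x y; rewrite bopD// bopN. Qed.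

Lemma bop_sum V W (T : V -> W) n (F : 'I_n -> V) : bounded_op T ->
  T (\sum_(i < n) F i) = \sum_(i < n) T (F i).
Proof. by move=> bT; apply: (big_morph T (bopD bT) (bop0 bT)). Qed.

Lemma bop_intro V W (T : V -> W) (c : R) :
  linear T -> (forall x, rnorm (T x) <= c * rnorm x) -> bounded_op T.
Proof.
move=> lT bT; split=> //.
pose L : {linear V -> W} := HB.pack T (GRing.isLinear.Build _ _ _ _ T lT).
apply/(linear_boundedP L); apply: filterS (nbhs_pinfty_ge (r := c%:C) _).
  move=> r /= cr x; apply: (@le_trans _ _ (c%:C * `|x|)).
    by rewrite !normE -rmorphM /= lecR.
  by rewrite ler_wpM2r.
by rewrite realE !lecR -realE num_real.
Qed.

Lemma bop_bound V W (T : V -> W) : bounded_op T ->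
  exists2 c : R, 0 <= c & forall x, rnorm (T x) <= c * rnorm x.
Proof.
move=> [lT bT].
pose L : {linear V -> W} := HB.pack T (GRing.isLinear.Build _ _ _ _ T lT).
have /pinfty_ex_gt0[r r0 h] := (linear_boundedP L).1 bT.
have rE : r = (complex.Re r)%:C.
  by move: r0; rewrite ltcE /= => /andP[/eqP ri _]; case: r ri {h} => ? ? /= ->.
exists (complex.Re r); first by move: r0; rewrite rE ltcR => /ltW.
by move=> x; have := h x; rewrite rE !normE -rmorphM /= lecR.
Qed.

Lemma opnorm_le V W (T : V -> W) (c : R) : 0 <= c ->
  (forall x, rnorm (T x) <= c * rnorm x) -> opnorm T <= c.
Proof.
move=> c0 h; apply: ge_sup.
  by exists (rnorm (T 0)); exists 0 => //=; rewrite normr0.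
move=> _ [x /= x1 <-]; apply: le_trans (h x) _.
by rewrite ler_piMr//; move: x1; rewrite normE lecR.
Qed.

Lemma opnorm_has_sup V W (T : V -> W) : bounded_op T ->
  has_sup [set rnorm (T x) | x in [set x : V | `|x| <= 1]].
Proof.
move=> bT; have [c c0 h] := bop_bound bT.
split; first by exists (rnorm (T 0)); exists 0 => //=; rewrite normr0.
exists c => _ [y /= y1 <-]; apply: le_trans (h y) _.
by rewrite ler_piMr//; move: y1; rewrite normE lecR.
Qed.

Lemma le_opnorm V W (T : V -> W) : bounded_op T ->
  forall x, rnorm (T x) <= opnorm T * rnorm x.
Proof.
move=> bT x; have [x0|x0] := eqVneq (rnorm x) 0.
  by rewrite (rnorm_eq0 x0) bop0// !rnorm0 mulr0.
have xp : 0 < rnorm x by rewrite lt0r x0 rnorm_ge0.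
rewrite -ler_pdivrMr//; apply: (sup_upper_bound (opnorm_has_sup bT)).
have ix : `|(rnorm x)^-1| = (rnorm x)^-1 by rewrite ger0_norm// invr_ge0 ltW.
exists ((rnorm x)^-1%:C *: x) => /=.
  by rewrite normE rnormZ ix mulVf.
by rewrite bopZ// rnormZ ix mulrC.
Qed.

Lemma opnorm_ge0 V W (T : V -> W) : bounded_op T -> 0 <= opnorm T.
Proof.
move=> bT; apply: (sup_upper_bound (opnorm_has_sup bT)).
by exists 0; rewrite /= ?normr0// bop0// rnorm0.
Qed.

Lemma bop_comp V W U (S : W -> U) (T : V -> W) :
  bounded_op S -> bounded_op T -> bounded_op (S \o T).
Proof.
move=> bS bT; have [c c0 hc] := bop_bound bS; have [d d0 hd] := bop_bound bT.
apply: (bop_intro (c := c * d)) => [a x y|x] /=.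
  by rewrite bopD// bopZ// bopD// bopZ.
by apply: le_trans (hc _) _; rewrite -mulrA ler_wpM2l.
Qed.

Lemma bop_add V W (S T : V -> W) :
  bounded_op S -> bounded_op T -> bounded_op (S \+ T).
Proof.
move=> bS bT; have [c c0 hc] := bop_bound bS; have [d d0 hd] := bop_bound bT.
apply: (bop_intro (c := c + d)) => [a x y|x] /=.
  by rewrite (bopD bS) (bopD bT) (bopZ bS) (bopZ bT) scalerDr addrACA.
by apply: le_trans (rnormD _ _) _; rewrite mulrDl lerD.
Qed.

Lemma bop_scale V W a (T : V -> W) : bounded_op T -> bounded_op (a \*: T).
Proof.
move=> bT; have [d d0 hd] := bop_bound bT.
apply: (bop_intro (c := complex.Re `|a| * d)) => [b x y|x] /=.
  by rewrite (bopD bT) (bopZ bT) scalerDr !scalerA mulrC.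
by rewrite rnormZC -mulrA ler_wpM2l// Re_norm_ge0.
Qed.

Lemma bop_sub V W (S T : V -> W) :
  bounded_op S -> bounded_op T -> bounded_op (S \- T).
Proof.
move=> bS bT; have := bop_add bS (bop_scale (-1) bT).
by congr bounded_op; apply/funext => x /=; rewrite scaleN1r.
Qed.

Lemma bop_id V : bounded_op (@id V).
Proof. by apply: (bop_intro (c := 1)) => // x; rewrite mul1r. Qed.

Lemma le_epsilon_mul (a b K : R) : 0 <= K ->
  (forall e, 0 < e -> a <= b + e * K) -> a <= b.
Proof.
move=> K0 h; apply/ler_addgt0Pl => e e0; have K1 : 0 < K + 1 by rewrite ltr_wpDl.
apply: le_trans (h (e / (K + 1)) _) _; first by rewrite divr_gt0.
rewrite addrC lerD2r mulrAC ler_pdivrMr// ler_wpM2l ?(ltW e0)//.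
by rewrite lerDl.
Qed.

Lemma bop_lim V W (L : V -> W) :
  (forall e : R, 0 < e -> exists2 S : V -> W, bounded_op S &
     forall x, rnorm (S x - L x) <= e * rnorm x) ->
  bounded_op L.
Proof.
move=> SL.
have close x y (K : R) : 0 <= K ->
    (forall e, 0 < e -> rnorm (x - y : W) <= e * K) -> x = y.
  move=> K0 h; apply/eqP; rewrite -subr_eq0; apply/eqP/rnorm_eq0/eqP.
  rewrite eq_le rnorm_ge0 andbT; apply: (le_epsilon_mul K0) => e e0.
  by rewrite add0r h.
have lL : linear L.
  move=> a x y.
  apply: (close _ _ (rnorm (a *: x + y) + (complex.Re `|a| * rnorm x + rnorm y))).
    by rewrite !addr_ge0 ?mulr_ge0 ?rnorm_ge0 ?Re_norm_ge0.
  move=> e e0; have [S bS hS] := SL _ e0.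
  have -> : L (a *: x + y) - (a *: L x + L y) =
     - (S (a *: x + y) - L (a *: x + y)) +
     (a *: (S x - L x) + (S y - L y)).
    rewrite (bopD bS) (bopZ bS) scalerBr opprB.
    by rewrite [X in _ = _ + X]addrACA -opprD addrA subrK.
  apply: le_trans (rnormD _ _) _; rewrite rnormN mulrDr lerD// mulrDr.
  apply: le_trans (rnormD _ _) _; rewrite lerD//.
  by rewrite rnormZC mulrCA ler_wpM2l ?Re_norm_ge0.
have [S bS hS] := SL 1 ltr01; have [c c0 hc] := bop_bound bS.
apply: (bop_intro (c := c + 1)) => // x.
have -> : L x = S x - (S x - L x) by rewrite subKr.
by apply: le_trans (rnormD _ _) _; rewrite rnormN mulrDl lerD.
Qed.

End BoundedOperators.

(** * Riesz representation and adjoints *)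

Section Riesz.
Context {R : realType}.
Implicit Types V W : hilbertType R.

Definition selfadj V (A : V -> V) := forall x y, rdot (A x) y = rdot x (A y).

Lemma selfadj_hdot V (A : V -> V) : bounded_op A -> selfadj A ->
  forall x y, hdot (A x) y = hdot x (A y).
Proof. by move=> bA sA x y; apply: hdot_ext; rewrite -?(bopZ bA) sA. Qed.

Lemma rdot_ext V (x y : V) : (forall z, rdot z x = rdot z y) -> x = y.
Proof.
move=> h; apply/eqP; rewrite -subr_eq0; apply/eqP/rnorm_eq0/eqP.
by rewrite -(@sqrf_eq0 R) -rdotxx rdotBr h subrr.
Qed.

(** The representing vector minimises the energy
    [<Px, x> - 2 phi x]: coercivity makes minimising sequences Cauchy, and
    the first variation at the minimum is the required identity. *)
Lemma coercive_riesz V (P : V -> V) (c K : R) (phi : V -> R) :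
  bounded_op P -> selfadj P -> 0 < c ->
  (forall x, c * rnorm x ^+ 2 <= rdot (P x) x) ->
  (forall x y, phi (x + y) = phi x + phi y) ->
  (forall (a : R) x, phi (a%:C *: x) = a * phi x) ->
  0 <= K -> (forall x, `|phi x| <= K * rnorm x) ->
  exists u, forall h, rdot h (P u) = phi h.
Proof.
move=> bP sP c0 cP phiD phiZ K0 phiK.
pose J x := rdot (P x) x - 2 * phi x.
have JD x y : J (x + y) = J x + 2 * (rdot y (P x) - phi y) + rdot (P y) y.
  rewrite /J (bopD bP) !rdotE phiD (sP y x) (rdotC y (P x)); ring.
have PZ (a : R) x : P (a%:C *: x) = a%:C *: P x by exact: bopZ.
have Jlb x : - (K ^+ 2 / c) <= J x.
  have := cP x; have := phiK x; rewrite ler_norml => /andP[_ h1] h2.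
  have r0 := rnorm_ge0 x; rewrite /J.
  apply: (@le_trans _ _ (c * rnorm x ^+ 2 - 2 * (K * rnorm x))); last by lra.
  rewrite -subr_ge0.
  have -> : c * rnorm x ^+ 2 - 2 * (K * rnorm x) - - (K ^+ 2 / c) =
     c * (rnorm x - K / c) ^+ 2 by field; rewrite gt_eqF.
  by rewrite mulr_ge0 ?sqr_ge0// ltW.
pose m := inf [set J x | x in [set: V]].
have hinf : has_inf [set J x | x in [set: V]].
  by split; [exists (J 0); exists 0 | exists (- (K ^+ 2 / c)) => _ [x _ <-]].
have mJ x : m <= J x by apply: ge_inf; [case: hinf | exists x].
have Jm (e : R) : 0 < e -> exists x, J x < m + e.
  by move=> e0; have [_ [x _ <-] h] := inf_adherent e0 hinf; exists x.
have [u0 u0P] : {u : nat -> V & forall n, J (u n) < m + n.+1%:R^-1}.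
  apply: (choice (P := fun n x => J x < m + n.+1%:R^-1)) => n.
  by apply: Jm; rewrite invr_gt0.
(* the parallelogram law, with the energy in place of the squared norm *)
have para x y : c * rnorm (x - y) ^+ 2 <= 2 * (J x - m) + 2 * (J y - m).
  apply: le_trans (cP _) _.
  have := mJ (2^-1%:C *: (x + y)).
  rewrite /J PZ (bopB bP) (bopD bP) !rdotE phiZ phiD (sP x y) (rdotC x (P y)).
  lra.
have [l ul] : exists l : V, forall e : R, 0 < e -> exists N : nat,
    forall n : nat, (N <= n)%N -> rnorm (u0 n - l) <= e.
  apply: rnorm_cvg => e e0.
  have d0 : 0 < c * e ^+ 2 / 4 by rewrite divr_gt0// mulr_gt0// exprn_gt0.
  have [N _ hN] := near_infty_natSinv_lt (PosNum d0).
  exists N => i j Ni Nj.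
  rewrite -(@ler_pXn2r _ 2)// ?nnegrE ?rnorm_ge0 ?(ltW e0)//.
  rewrite -(ler_pM2l c0); apply: le_trans (para _ _) _.
  have := u0P i; have := u0P j; have /= := hN _ Ni; have /= := hN _ Nj. 
  by move: (i.+1%:R^-1) (j.+1%:R^-1) => a b; lra.
(* [J] is continuous at [l]: [M * d] bounds the change of its linear part *)
have Jl : J l = m.
  apply/eqP; rewrite eq_le mJ andbT; apply/ler_addgt0Pl => e e0.
  pose M := rnorm (P l) + K + 1.
  have M1 : 1 <= M by rewrite lerDr !addr_ge0// rnorm_ge0.
  pose d := e / (4 * M).
  have d0 : 0 < d by rewrite divr_gt0// mulr_gt0//; lra.
  have [N hN] := ul d d0.
  have e2 : 0 < e / 2 by rewrite divr_gt0.
  have [N' _ hN'] := near_infty_natSinv_lt (PosNum e2).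
  pose n := maxn N N'.
  have hd := hN n (leq_maxl _ _).
  have /= hJ := hN' n (leq_maxr _ _).
  have := u0P n; move: (n.+1%:R^-1) hJ => a hJ.
  have dM : M * d = e / 4 by rewrite /d; field; rewrite gt_eqF//; lra.
  set y := u0 n - l in hd *.
  have -> : u0 n = l + y by rewrite /y addrC subrK.
  rewrite JD => h.
  have y0 := rnorm_ge0 y.
  have h1 : - (rnorm (P l) * d) <= rdot y (P l).
    have := rdot_CS y (P l); rewrite ler_norml => /andP[+ _].
    by apply: le_trans; rewrite lerN2 mulrC ler_wpM2l ?rnorm_ge0.
  have h2 : phi y <= K * d.
    apply: le_trans (ler_norm _) _; apply: le_trans (phiK _) _.
    by rewrite ler_wpM2l.
  have h3 : 0 <= rdot (P y) y.
    by apply: le_trans (cP _); rewrite mulr_ge0 ?sqr_ge0// ltW.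
  have h4 : M * d = rnorm (P l) * d + K * d + d by rewrite /M; ring.
  lra.
exists l => h; apply/eqP; rewrite -subr_eq0; set D := _ - phi h.
(* first variation: the parabola has its minimum at 0 *)
have var (t : R) : 0 <= 2 * t * D + t ^+ 2 * rdot (P h) h.
  have := mJ (l + t%:C *: h); rewrite -Jl JD PZ !rdotE phiZ /D; lra.
have Q0 : 0 <= rdot (P h) h.
  by apply: le_trans (cP _); rewrite mulr_ge0 ?sqr_ge0// ltW.
set Q := rdot (P h) h in var Q0.
have Q1 : 0 < Q + 1 by lra.
(* [- D / Q] would be optimal, but [Q] may vanish *)
have := var (- D / (Q + 1)).
have -> : 2 * (- D / (Q + 1)) * D + (- D / (Q + 1)) ^+ 2 * Q =
  - (D ^+ 2 * ((Q + 2) / (Q + 1) ^+ 2)) by field; rewrite gt_eqF.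
rewrite oppr_ge0 pmulr_lle0 ?divr_gt0 ?exprn_gt0//; last by lra.
by rewrite le_eqVlt ltNge sqr_ge0 orbF sqrf_eq0.
Qed.

Lemma adjoint_exists V (T : V -> V) : bounded_op T ->
  exists S : V -> V, bounded_op S /\ forall x y, hdot (T x) y = hdot x (S y).
Proof.
move=> bT; have [c c0 hc] := bop_bound bT.
have [S SP] : {S : V -> V & forall y x, rdot x (S y) = rdot (T x) y}.
  apply: (choice (P := fun y s => forall x, rdot x s = rdot (T x) y)) => y.
  apply: (@coercive_riesz V id 1 (c * rnorm y) (fun x => rdot (T x) y)) => //.
  - exact: bop_id.
  - by move=> x; rewrite mul1r rdotxx.
  - by move=> u v; rewrite (bopD bT) rdotE.
  - by move=> a u; rewrite (bopZ bT) rdotE.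
  - by rewrite mulr_ge0// rnorm_ge0.
  - move=> x; apply: le_trans (rdot_CS _ _) _.
    by rewrite mulrAC ler_wpM2r// rnorm_ge0.
have SH x y : hdot (T x) y = hdot x (S y).
  by apply: hdot_ext; rewrite -?(bopZ bT) SP.
exists S; split=> //; apply: (bop_intro (c := c)).
  move=> a x y; apply: rdot_ext => z; rewrite /rdot.
  by rewrite -SH hdotDr hdotZr hdotDr hdotZr !SH.
move=> x; have [x0|x0] := eqVneq (rnorm (S x)) 0.
  by rewrite x0 mulr_ge0// rnorm_ge0.
have xp : 0 < rnorm (S x) by rewrite lt0r x0 rnorm_ge0.
rewrite -(ler_pM2l xp) -expr2 -rdotxx SP.
apply: le_trans (rdot_le _ _) _.
by rewrite [leRHS]mulrCA mulrA ler_wpM2r// rnorm_ge0.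
Qed.

Lemma adjoint_spec V (T : V -> V) : bounded_op T ->
  bounded_op (adjoint T) /\ forall x y, hdot (T x) y = hdot x (adjoint T y).
Proof. by move=> bT; apply: (getPex (adjoint_exists bT)). Qed.

Lemma bop_adjoint V (T : V -> V) : bounded_op T -> bounded_op (adjoint T).
Proof. by case/adjoint_spec. Qed.

Lemma adjointE V (T : V -> V) : bounded_op T ->
  forall x y, rdot (T x) y = rdot x (adjoint T y).
Proof. by case/adjoint_spec => _ h x y; rewrite /rdot h. Qed.

Lemma adjointK V (T : V -> V) : bounded_op T -> adjoint (adjoint T) = T.
Proof.
move=> bT; apply/funext => x; apply: rdot_ext => z.
by rewrite -(adjointE (bop_adjoint bT)) rdotC -(adjointE bT) rdotC.
Qed.

End Riesz.

(** * Polynomials in a self-adjoint operator and its spectrum *)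

Section PolynomialCalculus.
Context {R : realType} {V : hilbertType R}.
Implicit Types (A B : V -> V) (p q r : {poly R}).

Definition cpoly_op (p : {poly R[i]}) A : V -> V :=
  fun x => \sum_(k < size p) p`_k *: iter k A x.

Lemma cpoly_opE (p : {poly R[i]}) A n x : (size p <= n)%N ->
  cpoly_op p A x = \sum_(k < n) p`_k *: iter k A x.
Proof.
move=> pn; rewrite /cpoly_op (big_ord_widen n (fun k => p`_k *: iter k A x) pn).
rewrite big_mkcond; apply: eq_bigr => i _.
by case: ltnP => // h; rewrite nth_default// scale0r.
Qed.

Lemma poly_opE p A : poly_op p A = cpoly_op (map_poly (@real_complex R) p) A.
Proof.
apply/funext => x; rewrite /poly_op /cpoly_op size_map_poly.
by apply: eq_bigr => k _; rewrite coef_map.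
Qed.

Lemma cpoly_opD (p q : {poly R[i]}) A x :
  cpoly_op (p + q) A x = cpoly_op p A x + cpoly_op q A x.
Proof.
pose n := maxn (size p) (size q).
rewrite !(@cpoly_opE _ _ n) ?leq_maxl ?leq_maxr//; last first.
  exact: size_polyD.
by rewrite -big_split /=; apply: eq_bigr => k _; rewrite coefD scalerDl.
Qed.

Lemma cpoly_opZ a (p : {poly R[i]}) A x :
  cpoly_op (a *: p) A x = a *: cpoly_op p A x.
Proof.
rewrite !(@cpoly_opE _ _ (size p)) ?size_scale_leq// scaler_sumr.
by apply: eq_bigr => k _; rewrite coefZ scalerA.
Qed.

Lemma cpoly_opC a A x : cpoly_op a%:P A x = a *: x.
Proof.
by rewrite (@cpoly_opE _ _ 1) ?size_polyC_leq1// big_ord1 /= coefC.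
Qed.

Lemma cpoly_opMX (p : {poly R[i]}) A x : bounded_op A ->
  cpoly_op (p * 'X) A x = A (cpoly_op p A x).
Proof.
move=> bA; rewrite (@cpoly_opE _ _ (size p).+1); last first.
  by apply: leq_trans (size_polyMleq _ _) _; rewrite size_polyX addn2.
rewrite big_ord_recl coefMX /= scale0r add0r.
rewrite /cpoly_op (bop_sum _ bA); apply: eq_bigr => k _.
by rewrite coefMX /= (bopZ bA).
Qed.

Lemma cpoly_opM (p q : {poly R[i]}) A x : bounded_op A ->
  cpoly_op (p * q) A x = cpoly_op p A (cpoly_op q A x).
Proof.
move=> bA; elim/poly_ind: p => [|p c ih] in x *.
  by rewrite mul0r -polyC0 !cpoly_opC !scale0r.
rewrite mulrDl mulrAC !cpoly_opD !cpoly_opMX// ih cpoly_opC; congr (_ + _).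
by rewrite mul_polyC cpoly_opZ.
Qed.

Lemma bop_cpoly (p : {poly R[i]}) A : bounded_op A -> bounded_op (cpoly_op p A).
Proof.
move=> bA; elim/poly_ind: p => [|p c ih].
  suff -> : cpoly_op 0 A = (0 : R[i]) \*: (@id V) by exact: bop_scale (bop_id V).
  by apply/funext => x; rewrite -polyC0 cpoly_opC.
suff -> : cpoly_op (p * 'X + c%:P) A = (A \o cpoly_op p A) \+ (c \*: (@id V)).
  by apply: bop_add; [exact: bop_comp | exact: bop_scale (bop_id V)].
by apply/funext => x; rewrite cpoly_opD cpoly_opMX// cpoly_opC.
Qed.

Lemma bop_poly p A : bounded_op A -> bounded_op (poly_op p A).
Proof. by move=> bA; rewrite poly_opE; exact: bop_cpoly. Qed.

Lemma poly_opD p q A x : poly_op (p + q) A x = poly_op p A x + poly_op q A x.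
Proof. by rewrite !poly_opE rmorphD /= cpoly_opD. Qed.

Lemma poly_opZ a p A x : poly_op (a *: p) A x = a%:C *: poly_op p A x.
Proof. by rewrite !poly_opE map_polyZ /= cpoly_opZ. Qed.

Lemma poly_opC a A x : poly_op a%:P A x = a%:C *: x.
Proof. by rewrite !poly_opE map_polyC /= cpoly_opC. Qed.

Lemma poly_opB p q A x : poly_op (p - q) A x = poly_op p A x - poly_op q A x.
Proof.
by rewrite poly_opD -scaleN1r poly_opZ rmorphN1 scaleN1r.
Qed.

Lemma poly_opM p q A x : bounded_op A ->
  poly_op (p * q) A x = poly_op p A (poly_op q A x).
Proof. by move=> bA; rewrite !poly_opE rmorphM /= cpoly_opM. Qed.

Lemma poly_opX A x : bounded_op A -> poly_op 'X A x = A x.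
Proof.
move=> bA; rewrite -['X]mul1r poly_opE rmorphM /= map_polyX cpoly_opMX//.
by rewrite rmorph1 cpoly_opC scale1r.
Qed.

Lemma selfadj_iter A k : selfadj A -> selfadj (iter k A).
Proof.
by move=> sA; elim: k => // k ih x y; rewrite iterS sA ih -iterSr.
Qed.

Lemma rdot_suml n (F : 'I_n -> V) y :
  rdot (\sum_(i < n) F i) y = \sum_(i < n) rdot (F i) y.
Proof.
apply: (big_morph (fun x => rdot x y)) => [u v|]; first exact: rdotDl.
exact: rdot0l.
Qed.

Lemma rdot_sumr n (F : 'I_n -> V) y :
  rdot y (\sum_(i < n) F i) = \sum_(i < n) rdot y (F i).
Proof. by rewrite rdotC rdot_suml; apply: eq_bigr => i _; rewrite rdotC. Qed.

Lemma selfadj_poly p A : selfadj A -> selfadj (poly_op p A).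
Proof.
move=> sA x y; rewrite /poly_op rdot_suml rdot_sumr; apply: eq_bigr => k _.
by rewrite rdotZl rdotZr (selfadj_iter k sA).
Qed.

Definition bounded_below A := exists2 c : R, 0 < c &
  forall x, c * rnorm x <= rnorm (A x).

Definition shift A (z : R[i]) : V -> V := fun x => A x - z *: x.

Lemma bop_shift A z : bounded_op A -> bounded_op (shift A z).
Proof.
by move=> bA; exact: (bop_sub bA (bop_scale z (bop_id V))).
Qed.

Lemma below_of_notin_spectrum A z : ~ spectrum A z -> bounded_below (shift A z).
Proof.
move=> /contrapT[S [bS _ SK]]; have [c c0 hc] := bop_bound bS.
have c1 : 0 < c + 1 by rewrite ltr_wpDl.
exists (c + 1)^-1; first by rewrite invr_gt0.
move=> x; rewrite mulrC ler_pdivrMr// -{1}(SK x).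
by apply: le_trans (hc _) _; rewrite mulrC ler_wpM2l ?rnorm_ge0// lerDl.
Qed.

Lemma below_comp A B :
  bounded_below A -> bounded_below B -> bounded_below (A \o B).
Proof.
move=> [c c0 hc] [d d0 hd]; exists (c * d); first exact: mulr_gt0.
by move=> x /=; apply: le_trans (hc _); rewrite -mulrA ler_wpM2l ?(ltW c0).
Qed.

Lemma rdotZC (z : R[i]) (x y : V) : rdot (z^*%R *: x) y = rdot x (z *: y).
Proof. by rewrite /rdot hdotZl hdotZr. Qed.

Lemma shift_adj A z x y : selfadj A ->
  rdot (shift A z^*%R x) y = rdot x (shift A z y).
Proof. by move=> sA; rewrite /shift rdotBl rdotBr sA rdotZC. Qed.

Lemma shiftC A z z' x : bounded_op A ->
  shift A z (shift A z' x) = shift A z' (shift A z x).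
Proof.
move=> bA; rewrite /shift !(bopB bA) !(bopZ bA) !scalerBr !scalerA mulrC.
by rewrite !opprB !addrA addrAC [RHS]addrAC; congr (_ + _); rewrite addrAC.
Qed.

(** A normal operator that is bounded below is invertible: its composition
    with its adjoint is coercive, hence onto. *)
Lemma notin_spectrum A z : bounded_op A -> selfadj A ->
  bounded_below (shift A z) -> ~ spectrum A z.
Proof.
move=> bA sA [c c0 hc]; apply; have bz := bop_shift z bA.
pose P x := shift A z^*%R (shift A z x).
have PE x y : rdot (P x) y = rdot (shift A z x) (shift A z y).
  by rewrite /P shift_adj.
have sP : selfadj P by move=> x y; rewrite PE [RHS]rdotC PE rdotC.
have [S SP] : {S : V -> V & forall y, shift A z (S y) = y}.
  apply: (choice (P := fun y s => shift A z s = y)) => y.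
  have [||||||||u hu] := @coercive_riesz R V P (c ^+ 2) (rnorm y) (fun x => rdot x y).
  - exact: bop_comp (bop_shift _ bA) bz.
  - exact: sP.
  - by rewrite exprn_gt0.
  - move=> x; rewrite PE rdotxx -exprMn.
    by rewrite ler_pXn2r// ?nnegrE ?mulr_ge0 ?rnorm_ge0// ltW.
  - by move=> *; rewrite rdotDl.
  - by move=> *; rewrite rdotZl.
  - exact: rnorm_ge0.
  - by move=> x; rewrite [leRHS]mulrC; exact: rdot_CS.
  exists (shift A z^*%R u); rewrite shiftC//; exact: rdot_ext.
have inj x y : shift A z x = shift A z y -> x = y.
  move=> xy; apply/eqP; rewrite -subr_eq0; apply/eqP/rnorm_eq0/eqP.
  rewrite eq_le rnorm_ge0 andbT -(pmulr_rle0 _ c0).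
  by apply: le_trans (hc _) _; rewrite (bopB bz) xy subrr rnorm0.
exists S; split.
- apply: (bop_intro (c := c^-1)).
    by move=> a x y; apply: inj; rewrite (bopD bz) (bopZ bz) !SP.
  by move=> x; rewrite ler_pdivlMl//; apply: le_trans (hc _) _; rewrite SP.
- by move=> y; exact: SP.
- by move=> y; apply: inj; rewrite SP.
Qed.

Lemma spectrum_real A z : bounded_op A -> selfadj A -> spectrum A z ->
  z = (complex.Re z)%:C.
Proof.
move=> bA sA; case: z => a b; have [->//|b0] := eqVneq b 0.
move=> sz; exfalso; move: sz; apply: notin_spectrum => //.
exists `|b|; first by rewrite normr_gt0.
move=> x; have [x0|x0] := eqVneq (rnorm x) 0; first by rewrite x0 mulr0 rnorm_ge0.
have xp : 0 < rnorm x by rewrite lt0r x0 rnorm_ge0.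
have ix : rnorm ('i *: x) = rnorm x.
  by rewrite rnormZC normc_def /= expr0n expr1n add0r sqrtr1 mul1r.
(* pairing [(A - z) x] with [i x] isolates the imaginary part of [z] *)
rewrite -(ler_pM2r xp) -[leRHS]/(_ * _) -{3}ix; apply: le_trans (rdot_CS _ _).
rewrite /shift rdotBl /rdot !hdotZr hdotZl hdot_real rdotxx.
have : hdot (A x) x = (hdot (A x) x)^*%R.
  by rewrite {1}(selfadj_hdot bA sA) hdotC.
case: (hdot (A x) x) => u v /eqP; rewrite eq_complex /= => /andP[_ /eqP v0].
rewrite [leRHS](_ : _ = `|- b * rnorm x ^+ 2|); last by congr `|_|; lra.
by rewrite normrM normrN (ger0_norm (sqr_ge0 _)) expr2 mulrA.
Qed.

Lemma spectrum_ge0 A t : bounded_op A -> selfadj A ->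
  (forall x, 0 <= rdot (A x) x) -> spectrum A t%:C -> 0 <= t.
Proof.
move=> bA sA pA; rewrite leNgt => st; apply/negP => t0; move: st.
apply: notin_spectrum => //; exists (- t); first by rewrite oppr_gt0.
move=> x; have [x0|x0] := eqVneq (rnorm x) 0; first by rewrite x0 mulr0 rnorm_ge0.
have xp : 0 < rnorm x by rewrite lt0r x0 rnorm_ge0.
rewrite -(ler_pM2r xp); apply: le_trans (rdot_le _ _).
by rewrite rdotBl rdotZl rdotxx -mulrA -expr2 mulNr lerDr.
Qed.

Lemma spectrum_le A (M t : R) : bounded_op A -> selfadj A ->
  (forall x, rnorm (A x) <= M * rnorm x) -> spectrum A t%:C -> t <= M.
Proof.
move=> bA sA hM; rewrite leNgt => st; apply/negP => t0; move: st.
apply: notin_spectrum => //; exists (t - M); first by rewrite subr_gt0.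
move=> x; have h : t * rnorm x <= rnorm (A x - t%:C *: x) + rnorm (A x).
  apply: (@le_trans _ _ (rnorm (t%:C *: x))).
    by rewrite rnormZ ler_wpM2r ?rnorm_ge0// ler_norm.
  rewrite -(rnormN (A x - _)) opprB.
  by apply: le_trans (rnormD _ _); rewrite subrK.
by have := hM x; rewrite /shift; lra.
Qed.

(** Over the complex numbers a polynomial splits, and a product of operators
    that are bounded below is bounded below. *)
Lemma poly_bounded_below A r : bounded_op A -> selfadj A -> r != 0 ->
  (forall t, spectrum A t%:C -> r.[t] != 0) -> bounded_below (poly_op r A).
Proof.
move=> bA sA r0 hr; rewrite poly_opE; set rc := map_poly _ r.
have rc0 : rc != 0 by rewrite map_poly_eq0.
have [s rcE] := closed_field_poly_normal rc.
have hs z : z \in s -> ~ spectrum A z.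
  move=> zs sz; have zE := spectrum_real bA sA sz.
  have : root rc z.
    by rewrite rcE rootZ ?lead_coef_eq0// root_prod_XsubC.
  rewrite {1}zE /root horner_map /= => /eqP[] h.
  by have := hr (complex.Re z); rewrite -zE h eqxx => /(_ sz).
rewrite rcE -mul_polyC.
have -> : cpoly_op ((lead_coef rc)%:P * \prod_(z <- s) ('X - z%:P)) A =
    (cpoly_op (lead_coef rc)%:P A) \o cpoly_op (\prod_(z <- s) ('X - z%:P)) A.
  by apply/funext => x; rewrite cpoly_opM.
apply: below_comp.
  exists (complex.Re `|lead_coef rc|).
    have : 0 < `|lead_coef rc| by rewrite normr_gt0 lead_coef_eq0.
    by case: (`|_|) => u v; rewrite ltcE => /andP[].
  by move=> x; rewrite cpoly_opC rnormZC.
elim: s hs {rcE} => [|z s ih] hs.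
  exists 1 => // x; rewrite big_nil -polyC1 cpoly_opC scale1r mul1r//.
have -> : cpoly_op (\prod_(z <- z :: s) ('X - z%:P)) A =
    shift A z \o cpoly_op (\prod_(z <- s) ('X - z%:P)) A.
  apply/funext => x; rewrite big_cons cpoly_opM// -polyCN cpoly_opD cpoly_opC.
  by rewrite -['X]mul1r cpoly_opMX// -polyC1 cpoly_opC scale1r scaleNr.
apply: below_comp; first by apply: below_of_notin_spectrum; apply: hs; rewrite mem_head.
by apply: ih => y ys; apply: hs; rewrite inE ys orbT.
Qed.

(** The spectral radius formula for a self-adjoint operator [B]: the operator
    [B ^ 2 - M ^ 2] with [M] the norm of [B] is not bounded below, since [B]
    stretches some unit vectors by almost [M]. *)
Lemma not_below_norm B : bounded_op B -> selfadj B ->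
  0 < opnorm B ->
  ~ bounded_below (fun x => B (B x) - (opnorm B ^+ 2)%:C *: x).
Proof.
move=> bB sB; set M := opnorm B => M0 [c c0 hc].
have M2 : 0 < M ^+ 2 by rewrite exprn_gt0.
have c2 : 0 < c ^+ 2 by rewrite exprn_gt0.
have hB x : rnorm (B x) ^+ 2 <= (M ^+ 2 - c ^+ 2 / M ^+ 2) * rnorm x ^+ 2.
  have : c ^+ 2 * rnorm x ^+ 2 <= rnorm (B (B x) - (M ^+ 2)%:C *: x) ^+ 2.
    by rewrite -exprMn ler_pXn2r// ?nnegrE ?mulr_ge0 ?rnorm_ge0// ltW.
  have : rnorm (B (B x)) ^+ 2 <= M ^+ 2 * rnorm (B x) ^+ 2.
    rewrite -exprMn ler_pXn2r// ?nnegrE ?mulr_ge0 ?rnorm_ge0 ?(ltW M0)//.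
    exact: le_opnorm.
  rewrite -[rnorm (_ - _) ^+ 2]rdotxx !rdotE (rdotC x) (sB (B x) x) !rdotxx => h1 h2.
  rewrite -(ler_pM2l M2).
  have -> : M ^+ 2 * ((M ^+ 2 - c ^+ 2 / M ^+ 2) * rnorm x ^+ 2) =
    (M ^+ 2 * M ^+ 2 - c ^+ 2) * rnorm x ^+ 2 by field; rewrite gt_eqF.
  lra.
have : M <= Num.sqrt (M ^+ 2 - c ^+ 2 / M ^+ 2).
  apply: opnorm_le; first exact: sqrtr_ge0.
  move=> x; rewrite -(@ler_pXn2r _ 2)// ?nnegrE ?mulr_ge0 ?rnorm_ge0 ?sqrtr_ge0//.
  rewrite exprMn; have [d0|d0] := leP 0 (M ^+ 2 - c ^+ 2 / M ^+ 2).
    by rewrite sqr_sqrtr.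
  rewrite ler0_sqrtr ?(ltW d0)// expr0n mul0r; apply: le_trans (hB x) _.
  by rewrite mulr_le0_ge0 ?sqr_ge0// ltW.
apply/negP; rewrite -ltNge -[ltRHS](ger0_norm (ltW M0)) -sqrtr_sqr ltr_sqrt//.
by rewrite ltrBlDr ltrDl divr_gt0.
Qed.

End PolynomialCalculus.

(** * The spectral bound and the continuous functional calculus *)

Section FunctionalCalculus.
Context {R : realType}.

Lemma unif_cvgP (D : set R) (u : nat -> R -> R) (f : R -> R) :
  {uniform D, u @ \oo --> f} <->
  forall e, 0 < e -> exists N, forall n, (N <= n)%N ->
    forall t, D t -> `|u n t - f t| <= e.
Proof.
split=> [uf e e0|h].
  have /uf [N _ hN] : nbhs (f : {uniform` D -> R})
      [set h | forall t, D t -> `|h t - f t| <= e].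
    apply/uniform_nbhs; exists [set xy | ball xy.1 e xy.2]; split.
      by rewrite -entourage_ballE; exists e.
    by move=> h /= hh t Dt; rewrite distrC; apply/ltW; exact: hh.
  by exists N => n; exact: hN.
move=> P /uniform_nbhs[E [+ EP]]; rewrite -entourage_ballE => -[e /= e0 eE].
have [|N hN] := h (e / 2); first by rewrite divr_gt0.
exists N => // n /= Nn; apply: EP => t Dt; apply: (eE (_, _)) => /=.
rewrite -ball_normE /= distrC; apply: le_lt_trans (hN _ Nn _ Dt) _.
by rewrite ltr_pdivrMr// ltr_pMr// ltr1n.
Qed.

Variable V : hilbertType R.
Implicit Types (A S : V -> V) (p q : {poly R}) (f g : R -> R).

(** The numbers [opnorm A] and [- opnorm A] are the roots of [X ^ 2 - |A| ^ 2],
    and one of them is in the spectrum unless [A = 0], where [0] is. *)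
Lemma spectrum_nonempty A (x : V) : bounded_op A -> selfadj A -> x != 0 ->
  exists t, spectrum A t%:C.
Proof.
move=> bA sA x0; apply: contrapT => /forallNP sp.
have [M0|M0] := ltP 0 (opnorm A).
  apply: (not_below_norm bA sA M0).
  have h : 'X * 'X - (opnorm A ^+ 2)%:P != 0.
    rewrite -size_poly_gt0 size_polyDl -?expr2 ?size_polyXn//.
    by rewrite size_polyN size_polyC; case: (_ != 0).
  have := poly_bounded_below bA sA h (fun t st => False_ind _ (sp t st)).
  move=> [c c0 hc]; exists c => // y.
  by have := hc y; rewrite poly_opB poly_opC poly_opM// !poly_opX.
have [c c0 hc] := below_of_notin_spectrum (sp 0).
have := hc x; rewrite /shift scale0r subr0 leNgt => /negP; apply.
apply: le_lt_trans (le_opnorm bA x) _; apply: (@le_lt_trans _ _ 0).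
  by rewrite mulr_le0_ge0 ?rnorm_ge0.
rewrite mulr_gt0// lt0r rnorm_ge0 andbT.
by apply: contraNneq x0 => /rnorm_eq0 ->.
Qed.

(** Where [q] stays below [K] on the spectrum, no root of [q ^ 2 - M ^ 2] with
    [M > K] lies in the spectrum, so [M] is not the norm of [q(A)]. *)
Lemma poly_spectral_bound A q K : bounded_op A -> selfadj A -> 0 <= K ->
  (forall t, spectrum A t%:C -> `|q.[t]| <= K) ->
  forall x, rnorm (poly_op q A x) <= K * rnorm x.
Proof.
move=> bA sA K0 hq x; set B := poly_op q A.
have bB : bounded_op B by exact: bop_poly.
have sB : selfadj B by exact: selfadj_poly.
apply: le_trans (le_opnorm bB x) _; rewrite ler_wpM2r ?rnorm_ge0//.
rewrite leNgt; apply/negP => KM; have M0 := le_lt_trans K0 KM.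
set M := opnorm B in KM M0.
pose r := q * q - (M ^+ 2)%:P.
have rE t : r.[t] = q.[t] ^+ 2 - M ^+ 2 by rewrite !hornerE expr2.
have nr t : spectrum A t%:C -> r.[t] != 0.
  move=> st; rewrite rE subr_eq0 lt_eqF// -real_normK ?num_real//.
  by rewrite ltr_pXn2r ?nnegrE ?(ltW M0)//; apply: le_lt_trans (hq _ st) _.
have [r0|r0] := eqVneq r 0.
  have [y y0] : exists y : V, y != 0.
    apply: contrapT => /forallNP h; have : M <= 0.
      apply: opnorm_le => // y; have /negP := h y; rewrite negbK => /eqP ->.
      by rewrite (bop0 bB) rnorm0 mulr0.
    by rewrite leNgt M0.
  have [t st] := spectrum_nonempty bA sA y0.
  by have := nr t st; rewrite r0 horner0 eqxx.
apply: (not_below_norm bB sB M0).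
have [c c0 hc] := poly_bounded_below bA sA r0 nr; exists c => // y.
by have := hc y; rewrite poly_opB poly_opC poly_opM.
Qed.

(** [S] is [f(A)]: simultaneous approximation of [f] on the spectrum and of
    [S] in norm, by one polynomial. *)
Definition fcalc A f S := forall e : R, 0 < e -> exists p,
  (forall t, spectrum A t%:C -> `|p.[t] - f t| <= e) /\
  (forall x, rnorm (poly_op p A x - S x) <= e * rnorm x).

Definition approximable (D : set R) f := forall e : R, 0 < e ->
  exists p : {poly R}, forall t, D t -> `|p.[t] - f t| <= e.

Section SelfAdjoint.
Variable A : V -> V.
Hypotheses (bA : bounded_op A) (sA : selfadj A).
Let sigma := [set t : R | spectrum A t%:C].

Lemma fcalc_bop f S : fcalc A f S -> bounded_op S.
Proof.
move=> fS; apply: bop_lim => e e0; have [p [_ hp]] := fS _ e0.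
by exists (poly_op p A) => //; exact: bop_poly.
Qed.

Lemma rdot_close (x x' y : V) (e : R) : rnorm (x - x') <= e ->
  `|rdot x y - rdot x' y| <= e * rnorm y.
Proof.
move=> h; rewrite -rdotBl; apply: le_trans (rdot_CS _ _) _.
by rewrite ler_wpM2r// rnorm_ge0.
Qed.

Lemma fcalc_selfadj f S : fcalc A f S -> selfadj S.
Proof.
move=> fS x y; apply/eqP; rewrite -subr_eq0 -normr_le0.
apply: (@le_epsilon_mul _ _ _ (2 * (rnorm x * rnorm y))).
  by rewrite !mulr_ge0// rnorm_ge0.
move=> e e0; have [p [_ hp]] := fS _ e0.
have h1 := rdot_close y (hp x).
have h2 := rdot_close x (hp y).
rewrite (selfadj_poly p sA) in h1; rewrite rdotC (rdotC _ x) in h2.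
by move: h1 h2; rewrite !ler_norml => /andP[? ?] /andP[? ?]; apply/andP; split; lra.
Qed.

Lemma fcalc_norm f S K : fcalc A f S -> 0 <= K ->
  (forall t, sigma t -> `|f t| <= K) -> forall x, rnorm (S x) <= K * rnorm x.
Proof.
move=> fS K0 fK x.
apply: (@le_epsilon_mul _ _ _ (2 * rnorm x)); first by rewrite mulr_ge0// rnorm_ge0.
move=> e e0; have [p [pf hp]] := fS _ e0.
have pK : forall t, sigma t -> `|p.[t]| <= K + e.
  move=> t st; rewrite -(subrK (f t) p.[t]) addrC.
  by apply: le_trans (ler_normD _ _) _; rewrite lerD ?fK ?pf.
have Ke : 0 <= K + e by rewrite addr_ge0// ltW.
have := poly_spectral_bound bA sA Ke pK x; have := hp x.
have : rnorm (S x) <= rnorm (poly_op p A x) + rnorm (poly_op p A x - S x).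
  have -> : rnorm (S x) = rnorm (poly_op p A x - (poly_op p A x - S x)).
    by rewrite subKr.
  by apply: le_trans (rnormD _ _) _; rewrite rnormN.
lra.
Qed.

Lemma fcalc_poly p : fcalc A (horner p) (poly_op p A).
Proof.
move=> e e0; exists p; split=> [t _|x]; first by rewrite subrr normr0 ltW.
by rewrite subrr rnorm0 mulr_ge0 ?(ltW e0)// rnorm_ge0.
Qed.

Lemma fcalc_ext f g S : fcalc A f S -> (forall t, sigma t -> f t = g t) ->
  fcalc A g S.
Proof.
move=> fS fg e e0; have [p [pf hp]] := fS _ e0; exists p; split=> // t st.
by rewrite -fg//; exact: pf.
Qed.

Lemma fcalc_id : fcalc A id A.
Proof.
have := @fcalc_poly 'X; have -> : poly_op 'X A = A.
  by apply/funext => x; rewrite poly_opX.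
by move/fcalc_ext; apply => t _; rewrite hornerX.
Qed.

Lemma fcalc_scalar (c : R) : fcalc A (cst c) (fun x => c%:C *: x).
Proof.
have := @fcalc_poly c%:P.
have -> : poly_op c%:P A = (fun x => c%:C *: x).
  by apply/funext => x; rewrite poly_opC.
by move/fcalc_ext; apply => t _; rewrite hornerC.
Qed.

Lemma fcalc_lin (a : R) f g S S' : fcalc A f S -> fcalc A g S' ->
  fcalc A (fun t => f t + a * g t) (fun x => S x + a%:C *: S' x).
Proof.
move=> fS gS' e e0; pose d := e / (1 + `|a|).
have a1 : 0 < 1 + `|a| by rewrite ltr_pwDl.
have d0 : 0 < d by rewrite divr_gt0.
have dE : e = d + `|a| * d by rewrite /d; field; rewrite gt_eqF.
have [p [pf hp]] := fS _ d0; have [q [qg hq]] := gS' _ d0.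
exists (p + a *: q); split=> [t st|x].
  rewrite !hornerE.
  have -> : p.[t] + a * q.[t] - (f t + a * g t) =
    (p.[t] - f t) + a * (q.[t] - g t) by ring.
  apply: le_trans (ler_normD _ _) _; rewrite dE lerD ?pf// normrM.
  by rewrite ler_wpM2l// qg.
rewrite poly_opD poly_opZ opprD addrACA -scalerBr.
apply: le_trans (rnormD _ _) _; rewrite rnormZ dE mulrDl lerD// -mulrA.
by rewrite ler_wpM2l.
Qed.

Lemma fcalc_mul f g S S' K : fcalc A f S -> fcalc A g S' ->
  (forall t, sigma t -> `|f t| <= K) -> (forall t, sigma t -> `|g t| <= K) ->
  0 <= K -> fcalc A (fun t => f t * g t) (S \o S').
Proof.
move=> fS gS' fK gK K0 e e0; pose d := Num.min 1 (e / (2 * K + 1)).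
have K1 : 0 < 2 * K + 1 by lra.
have d0 : 0 < d by rewrite lt_min ltr01 divr_gt0.
have d1 : d <= 1 by rewrite ge_min lexx.
have dE : d * (2 * K + 1) <= e.
  by rewrite -ler_pdivlMr// ge_min lexx orbT.
have dK : d * (K + d) + K * d <= e.
  apply: le_trans dE; rewrite -subr_ge0.
  have -> : d * (2 * K + 1) - (d * (K + d) + K * d) = d * (1 - d) by ring.
  by rewrite mulr_ge0 ?subr_ge0// ltW.
have [p [pf hp]] := fS _ d0; have [q [qg hq]] := gS' _ d0.
have pK t : sigma t -> `|p.[t]| <= K + d.
  move=> st; rewrite -(subrK (f t) p.[t]) addrC.
  by apply: le_trans (ler_normD _ _) _; rewrite lerD ?fK ?pf.
exists (p * q); split=> [t st|x].
  rewrite hornerM.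
  have -> : p.[t] * q.[t] - f t * g t =
    (q.[t] - g t) * p.[t] + g t * (p.[t] - f t) by ring.
  apply: le_trans dK; apply: le_trans (ler_normD _ _) _; rewrite !normrM.
  by rewrite lerD// ler_pM// ?pK ?qg ?gK ?pf.
rewrite poly_opM//=.
have -> : poly_op p A (poly_op q A x) - S (S' x) =
   poly_op p A (poly_op q A x - S' x) + (poly_op p A (S' x) - S (S' x)).
  by rewrite (bopB (bop_poly p bA)) addrA subrK.
apply: le_trans (rnormD _ _) _.
apply: (@le_trans _ _ ((d * (K + d) + K * d) * rnorm x)); last first.
  by rewrite ler_wpM2r// rnorm_ge0.
rewrite mulrDl lerD//.
  apply: le_trans (poly_spectral_bound bA sA _ pK _) _.
    by rewrite addr_ge0// ltW.
  by rewrite (mulrC d) -mulrA ler_wpM2l ?addr_ge0 ?(ltW d0).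
apply: le_trans (hp _) _; rewrite (mulrC K) -mulrA ler_wpM2l ?(ltW d0)//.
exact: fcalc_norm gS' K0 gK x.
Qed.

(** The calculus depends on the values on the spectrum alone: this makes any
    choice of approximating polynomials as good as another. *)
Lemma fcalc_uniq f g S S' : fcalc A f S -> fcalc A g S' ->
  (forall t, sigma t -> f t = g t) -> S = S'.
Proof.
move=> fS gS' fg; apply/funext => x; apply/eqP; rewrite -subr_eq0.
apply/eqP/rnorm_eq0/eqP; rewrite eq_le rnorm_ge0 andbT.
have h t : sigma t -> `|f t + -1 * g t| <= 0.
  by move=> st; rewrite fg// mulN1r subrr normr0.
have := fcalc_norm (fcalc_lin (-1) fS gS') (lexx 0) h x.
by rewrite rmorphN1 scaleN1r mul0r.
Qed.

(** If [0 <= f <= K] then [f - K / 2] is at most [K / 2] in modulus, so the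
    operator is within [K / 2] of the scalar [K / 2]. *)
Lemma fcalc_ge0 f S K : fcalc A f S ->
  (forall t, sigma t -> 0 <= f t <= K) -> forall x, 0 <= rdot (S x) x.
Proof.
move=> fS fK x; case: (leP 0 K) => [K0|K0]; last first.
  have h := fcalc_norm fS (lexx 0).
  suff -> : S x = 0 by rewrite rdot0l.
  apply/rnorm_eq0/eqP; rewrite eq_le rnorm_ge0 andbT -(mul0r (rnorm x)).
  by apply: h => t /fK; lra.
have K2 : 0 <= K / 2 by lra.
have h : forall t, sigma t -> `|f t + - (K / 2) * cst 1 t| <= K / 2.
  by move=> t /fK /andP[f0 fK']; rewrite mulr1 ler_norml; apply/andP; split; lra.
have := fcalc_norm (fcalc_lin (- (K / 2)) fS (fcalc_scalar 1)) K2 h x.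
rewrite scale1r => hn.
have := rdot_CS (S x + (- (K / 2))%:C *: x) x.
rewrite rdotDl rdotZl rdotxx ler_norml => /andP[h1 _].
have := ler_wpM2r (rnorm_ge0 x) hn; rewrite -(mulrA (K / 2)) -expr2; lra.
Qed.

(** Domination of functions on the spectrum becomes domination of operators,
    because [g(A)^2 - f(A)^2] is positive. *)
Lemma fcalc_dominated f g S S' K : fcalc A f S -> fcalc A g S' ->
  (forall t, sigma t -> `|f t| <= `|g t| <= K) ->
  forall x, rnorm (S x) <= rnorm (S' x).
Proof.
move=> fS gS' fg x.
wlog K0 : K fg / 0 <= K.
  move=> /(_ `|K|); apply=> // t /fg /andP[-> h] /=.
  exact: le_trans h (ler_norm _).
have fK t : sigma t -> `|f t| <= K by move=> /fg /andP[]; exact: le_trans.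
have gK t : sigma t -> `|g t| <= K by move=> /fg /andP[].
have h := fcalc_lin (-1) (fcalc_mul gS' gS' gK gK K0) (fcalc_mul fS fS fK fK K0).
have := fcalc_ge0 (K := K ^+ 2) h _ x; rewrite /= rdotDl rdotZl.
rewrite (fcalc_selfadj fS) (fcalc_selfadj gS') !rdotxx => H.
rewrite -(@ler_pXn2r _ 2)// ?nnegrE ?rnorm_ge0// -subr_ge0 -mulN1r; apply: H.
move=> t st; have /andP[h1 h2] := fg t st; have g0 := normr_ge0 (f t).
rewrite mulN1r -!expr2 -(real_normK (num_real (f t))) -(real_normK (num_real (g t))).
apply/andP; split; first by rewrite subr_ge0 ler_pXn2r ?nnegrE.
apply: (@le_trans _ _ (`|g t| ^+ 2)); first by rewrite gerBl sqr_ge0.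
by rewrite ler_pXn2r ?nnegrE.
Qed.

(** By [poly_spectral_bound] the approximating polynomials of the operator form
    a Cauchy sequence in norm. *)
Lemma fcalc_exists f : approximable sigma f -> exists S,
  bounded_op S /\
  exists p : nat -> {poly R},
    {uniform sigma, (fun k t => (p k).[t]) @ \oo --> f} /\
    opnorm (poly_op (p k) A \- S) @[k --> \oo] --> (0 : R).
Proof.
move=> fa.
have e_gt0 n : 0 < n.+1%:R^-1 :> R by rewrite invr_gt0.
have [p pf] : {p : nat -> {poly R} &
    forall n t, sigma t -> `|(p n).[t] - f t| <= n.+1%:R^-1}.
  exact: (choice (P := fun n p => forall t, sigma t -> `|p.[t] - f t| <= n.+1%:R^-1)
    (fun n => fa _ (e_gt0 n))).
have small (e : R) : 0 < e -> exists N, forall n, (N <= n)%N -> n.+1%:R^-1 <= e.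
  move=> e0; have [N _ hN] := near_infty_natSinv_lt (PosNum e0).
  by exists N => n Nn; apply/ltW; exact: hN.
have pmn m n x : rnorm (poly_op (p m) A x - poly_op (p n) A x) <=
    (m.+1%:R^-1 + n.+1%:R^-1) * rnorm x.
  rewrite -poly_opB; apply: poly_spectral_bound => //.
  move=> t st; rewrite hornerD hornerN.
  have -> : (p m).[t] - (p n).[t] = ((p m).[t] - f t) - ((p n).[t] - f t) by ring.
  by apply: le_trans (ler_normB _ _) _; rewrite lerD ?pf.
have [S SP] : {S : V -> V & forall x (e : R), 0 < e -> exists N : nat,
    forall n : nat, (N <= n)%N -> rnorm (poly_op (p n) A x - S x) <= e}.
  apply: (choice (P := fun x s => forall e : R, 0 < e -> exists N : nat,
    forall n : nat, (N <= n)%N -> rnorm (poly_op (p n) A x - s) <= e)) => x.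
  apply: rnorm_cvg => e e0; have K1 : 0 < 2 * (rnorm x + 1).
    by rewrite mulr_gt0// ltr_wpDl// rnorm_ge0.
  have [|N hN] := small (e / (2 * (rnorm x + 1))); first by rewrite divr_gt0.
  exists N => m n Nm Nn; apply: le_trans (pmn _ _ _) _.
  have := hN m Nm; have := hN n Nn; move: (m.+1%:R^-1) (n.+1%:R^-1) (e_gt0 m) (e_gt0 n).
  move=> a b a0 b0; rewrite !ler_pdivlMr// => h1 h2.
  have := rnorm_ge0 x; nra.
have SB n x : rnorm (poly_op (p n) A x - S x) <= n.+1%:R^-1 * rnorm x.
  apply: (@le_epsilon_mul _ _ _ (rnorm x + 1)).
    by rewrite addr_ge0// rnorm_ge0.
  move=> e e0; have [N hN] := SP x _ e0; have [N' hN'] := small _ e0.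
  pose k := maxn N N'.
  have := hN k (leq_maxl _ _); have := hN' k (leq_maxr _ _); have := pmn n k x.
  have -> : poly_op (p n) A x - S x = (poly_op (p n) A x - poly_op (p k) A x)
     + (poly_op (p k) A x - S x) by rewrite addrA subrK.
  move=> h1 h2 h3; apply: le_trans (rnormD _ _) _.
  have := ler_wpM2r (rnorm_ge0 x) h2; move: h1 h3; rewrite mulrDl.
  move: (_^-1 * _) (_^-1 * _) => a b; lra.
have bS : bounded_op S.
  apply: bop_lim => e e0; have [N hN] := small _ e0.
  exists (poly_op (p N) A); first exact: bop_poly.
  by move=> x; apply: le_trans (SB _ _) _; rewrite ler_wpM2r ?rnorm_ge0// hN.
exists S; split=> //; exists p; split.
  apply/unif_cvgP => e e0; have [N hN] := small _ e0; exists N => n Nn t st.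
  exact: le_trans (pf _ _ st) (hN _ Nn).
apply/cvgrPdist_le => e e0; have [N hN] := small _ e0; exists N => // n /= Nn.
rewrite sub0r normrN ger0_norm; last first.
  by apply: opnorm_ge0; apply: bop_sub => //; exact: bop_poly.
apply: opnorm_le; first exact: ltW.
by move=> x /=; apply: le_trans (SB _ _) _; rewrite ler_wpM2r ?rnorm_ge0// hN.
Qed.

Lemma cfc_fcalc f : approximable sigma f -> fcalc A f (cfc f A).
Proof.
move=> fa; have [bS [p [pf pS]]] := getPex (fcalc_exists fa).
rewrite -/(cfc f A) in bS pS.
move=> e e0; have /unif_cvgP/(_ e e0)[N hN] := pf.
have /cvgrPdist_le/(_ e e0)[N' _ hN'] := pS.
pose n := maxn N N'; exists (p n); split.
  by move=> t st; apply: hN => //; rewrite leq_maxl.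
have := hN' n (leq_maxr _ _).
have bD : bounded_op (poly_op (p n) A \- cfc f A).
  by apply: bop_sub => //; exact: bop_poly.
rewrite /= sub0r normrN ger0_norm ?opnorm_ge0// => h x.
apply: le_trans (le_opnorm bD x) _.
by rewrite ler_wpM2r// rnorm_ge0.
Qed.

End SelfAdjoint.

(** The same polynomials approximate both sides, and polynomials of
    intertwined operators are intertwined. *)
Lemma fcalc_intertwine A B (T : V -> V) f S S' :
  bounded_op A -> selfadj A -> bounded_op B -> selfadj B -> bounded_op T ->
  (forall x, T (A x) = B (T x)) ->
  approximable [set t | spectrum A t%:C \/ spectrum B t%:C] f ->
  fcalc A f S -> fcalc B f S' -> forall x, T (S x) = S' (T x).
Proof.
move=> bA sA bB sB bT TAB fa fS fS' x.
have Tp p y : T (poly_op p A y) = poly_op p B (T y).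
  rewrite /poly_op (bop_sum _ bT); apply: eq_bigr => k _; rewrite (bopZ bT).
  by congr (_ *: _); elim: (k : nat) => //= j <-.
have [c c0 hc] := bop_bound bT.
apply/eqP; rewrite -subr_eq0; apply/eqP/rnorm_eq0/eqP.
rewrite eq_le rnorm_ge0 andbT; apply: (@le_epsilon_mul _ _ _ (2 * (c * rnorm x))).
  by rewrite !mulr_ge0// rnorm_ge0.
move=> e e0; have [p hp] := fa _ e0.
have close C Z : bounded_op C -> selfadj C -> fcalc C f Z ->
    (forall t, spectrum C t%:C -> `|p.[t] - f t| <= e) ->
    forall y, rnorm (poly_op p C y - Z y) <= e * rnorm y.
  move=> bC sC fZ pe y.
  have h t : spectrum C t%:C -> `|p.[t] + -1 * f t| <= e.
    by move=> st; rewrite mulN1r pe.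
  have := fcalc_norm bC sC (fcalc_lin (-1) (fcalc_poly C p) fZ) (ltW e0) h y.
  by rewrite rmorphN1 scaleN1r.
have h1 := close _ _ bA sA fS (fun t st => hp t (or_introl st)) x.
have h2 := close _ _ bB sB fS' (fun t st => hp t (or_intror st)) (T x).
have -> : T (S x) - S' (T x) =
    - T (poly_op p A x - S x) + (poly_op p B (T x) - S' (T x)).
  by rewrite (bopB bT) Tp opprB addrA subrK.
apply: le_trans (rnormD _ _) _; rewrite rnormN add0r.
have := hc (poly_op p A x - S x); have := hc x; nra.
Qed.

End FunctionalCalculus.

(** * Polynomial approximation of continuous functions *)

Section Weierstrass.
Context {R : realType}.
Implicit Types (phi psi : nat -> R) (f : R -> R).

(** The Bernstein polynomial with values [phi k] at the nodes [k = 0, .., n], as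
    the mean of [phi] after [n] tosses of a coin of bias ['X]. Conditioning on
    the first toss gives a recursion free of binomial coefficients, by which
    all the moments below are computed. *)
Fixpoint bernstein n phi : {poly R} :=
  if n is n'.+1 then
    'X * bernstein n' (phi \o S) + (1 - 'X) * bernstein n' phi
  else (phi 0)%:P.

Lemma bernsteinS n phi x : (bernstein n.+1 phi).[x] =
  x * (bernstein n (phi \o S)).[x] + (1 - x) * (bernstein n phi).[x].
Proof. by rewrite /= !hornerE. Qed.

Lemma bernstein_affine n phi a c x :
  (bernstein n (fun k => a + c * phi k)).[x] = a + c * (bernstein n phi).[x].
Proof.
elim: n phi => [|n ih] phi; first by rewrite /= !hornerC.
by rewrite !bernsteinS /comp (ih (fun k => phi k.+1)) ih /comp; ring.
Qed.

Lemma bernstein_variance n a x :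
  (bernstein n (fun k => (k%:R - a) ^+ 2)).[x] =
  (n%:R * x - a) ^+ 2 + n%:R * x * (1 - x).
Proof.
elim: n a => [|n ih] a; first by rewrite /= hornerC; ring.
rewrite bernsteinS ih.
have -> : (fun k => (k%:R - a) ^+ 2) \o S = fun k => (k%:R - (a - 1)) ^+ 2.
  by apply/funext => k /=; rewrite -natr1; ring.
by rewrite ih -natr1; ring.
Qed.

Lemma bernstein_dominated n phi psi x : 0 <= x <= 1 ->
  (forall k, (k <= n)%N -> `|phi k| <= psi k) ->
  `|(bernstein n phi).[x]| <= (bernstein n psi).[x].
Proof.
move=> /andP[x0 x1]; elim: n phi psi => [|n ih] phi psi h.
  by rewrite /= !hornerC h.
rewrite !bernsteinS; apply: le_trans (ler_normD _ _) _; rewrite !normrM.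
have x1' : 0 <= 1 - x by rewrite subr_ge0.
rewrite (ger0_norm x0) (ger0_norm x1') lerD// ler_wpM2l//; apply: ih => k kn.
  exact: h.
by apply: h; exact: leqW.
Qed.

Lemma within_nneg_continuousP f : {within `[0, +oo[, continuous f} ->
  forall x : R, 0 <= x -> forall e : R, 0 < e ->
  exists2 d : R, 0 < d & forall y : R, 0 <= y -> `|x - y| < d -> `|f x - f y| < e.
Proof.
move=> /subspace_continuousP fc x x0 e e0.
have := fc x; rewrite /= in_itv /= x0 => /(_ isT) /cvgrPdist_lt /(_ e e0).
move=> [d /= d0 h]; exists d => // y y0 xy.
by apply: h => //=; rewrite in_itv /= y0.
Qed.

Lemma segment_unif_continuous f (M : R) : {within `[0, +oo[, continuous f} ->
  forall e : R, 0 < e -> exists2 d : R, 0 < d &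
  forall x y : R, 0 <= x <= M -> 0 <= y <= M -> `|x - y| < d -> `|f x - f y| <= e.
Proof.
move=> fc e e0; have e2 : 0 < e / 2 by rewrite divr_gt0.
have /compact_near_coveringP K := @segment_compact R 0 M.
pose P (d x : R) := 0 <= x -> forall y : R, 0 <= y -> `|x - y| < d -> `|f x - f y| <= e.
have /K : forall x, `[0, M]%classic x ->
    \forall x' \near x & d \near (0 : R)^'+, P d x'.
  move=> x /=; rewrite in_itv /= => /andP[x0 _].
  have [d d0 hd] := within_nneg_continuousP fc x0 e2.
  have d2 : 0 < d / 2 by rewrite divr_gt0.
  near=> x' d' => /= x'0 y y0 xy.
  have h1 : `|x - x'| < d / 2 by near: x'; exact: cvgr_dist_lt.
  have h2 : d' < d / 2 by near: d'; exact: nbhs_right_lt.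
  have xx' := hd x' x'0; have xxy := hd y y0.
  rewrite -(subrK (f x) (f x')) -addrA; apply: le_trans (ler_normD _ _) _.
  rewrite distrC [leRHS](splitr e) lerD// ltW//.
    by apply: xx'; apply: lt_le_trans h1 _; lra.
  apply: xxy; rewrite -(subrK x' x) -addrA; apply: le_lt_trans (ler_normD _ _) _.
  lra.
move=> H.
have [d [d0 hd]] : exists d : R, 0 < d /\ `[0, M]%classic `<=` P d.
  near (0 : R)^'+ => d; exists d; split; near: d; [exact: nbhs_right_gt|exact: H].
exists d => // x y xM /andP[y0 _]; apply: hd => //=; last by case/andP: xM.
Unshelve. all: by end_near. Qed.

Lemma segment_bounded f (M : R) : 0 <= M -> {within `[0, +oo[, continuous f} ->
  exists2 K : R, 0 <= K & forall t : R, 0 <= t <= M -> `|f t| <= K.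
Proof.
move=> M0 fc.
have fM : {within `[0, M], continuous f}.
  by apply: continuous_subspaceW fc => x /=; rewrite !in_itv /= andbT => /andP[].
have [a _ ha] := EVT_max M0 fM; have [b _ hb] := EVT_min M0 fM.
exists (`|f a| + `|f b|) => [|t tM]; first by rewrite addr_ge0.
have := ha t; have := hb t; rewrite in_itv /= tM => /(_ isT) h1 /(_ isT) h2.
have := ler_norm (f a); have := ler_norm (- f b); rewrite normrN.
have := normr_ge0 (f a); have := normr_ge0 (f b).
by rewrite ler_norml => *; apply/andP; split; lra.
Qed.

(** Nodes near the argument contribute at most [e / 2] by uniform continuity;
    elsewhere the error, at most [2 K], is dominated by a multiple of the
    squared deviation of the walk, whose mean is [O(1 / n)] after rescaling. *)
Lemma weierstrass f (M : R) : 0 < M -> {within `[0, +oo[, continuous f} ->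
  approximable [set t | 0 <= t <= M] f.
Proof.
move=> M0 fc e e0; have e2 : 0 < e / 2 by rewrite divr_gt0.
have [K K0 fK] := segment_bounded (ltW M0) fc.
have [d d0 fd] := segment_unif_continuous M fc e2.
have d2 : 0 < d ^+ 2 by rewrite exprn_gt0.
have r0 : 0 < e / 2 / (2 * K / d ^+ 2 * M ^+ 2 + 1).
  by rewrite divr_gt0// ltr_wpDl// !mulr_ge0// ?invr_ge0 ltW.
have [N _ hN] := near_infty_natSinv_lt (PosNum r0).
pose n := N.+1; have /= {}hN := hN N (leqnn _).
have n0 : 0 < n%:R :> R by rewrite ltr0n.
pose phi k := f (k%:R * (M / n%:R)).
exists (bernstein n phi \Po (M^-1 *: 'X)) => t /= tM.
rewrite horner_comp hornerZ hornerX; set x := M^-1 * t.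
have tE : t = x * M by rewrite /x mulrC mulrA divff ?mul1r ?gt_eqF.
have x01 : 0 <= x <= 1.
  by move: tM => /andP[t0 tM]; rewrite /x mulrC divr_ge0 ?(ltW M0)//= ler_pdivrMr// mul1r.
pose c := 2 * K / d ^+ 2 * (M / n%:R) ^+ 2.
have -> : (bernstein n phi).[x] - f t =
    (bernstein n (fun k => - f t + 1 * phi k)).[x].
  by rewrite bernstein_affine mul1r addrC.
have node k : (k <= n)%N -> 0 <= k%:R * (M / n%:R) <= M.
  move=> kn; rewrite mulr_ge0 ?divr_ge0 ?(ltW M0) ?(ltW n0)//=.
  by rewrite mulrA ler_pdivrMr// mulrC ler_pM2l// ler_nat.
have dom k : (k <= n)%N ->
    `|- f t + 1 * phi k| <= e / 2 + c * (k%:R - n%:R * x) ^+ 2.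
  move=> kn; rewrite mul1r addrC; have h := node k kn.
  have cE : c * (k%:R - n%:R * x) ^+ 2 =
      2 * K * ((k%:R * (M / n%:R) - t) ^+ 2 / d ^+ 2).
    by rewrite /c tE; field; rewrite !gt_eqF.
  have [close|far] := ltP `|k%:R * (M / n%:R) - t| d.
    apply: le_trans (fd _ _ h tM close) _; rewrite lerDl cE.
    by rewrite mulr_ge0 ?divr_ge0 ?sqr_ge0// mulr_ge0.
  apply: (@le_trans _ _ (2 * K)).
    apply: le_trans (ler_normB _ _) _.
    by have := fK _ h; have := fK _ tM; rewrite /phi; lra.
  rewrite cE -[leLHS]addr0 addrC lerD ?(ltW e2)// ler_peMr ?mulr_ge0//.
  rewrite ler_pdivlMr// mul1r -(real_normK (num_real (_ - _))).
  by rewrite ler_pXn2r ?nnegrE// ltW.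
apply: le_trans (bernstein_dominated x01 dom) _.
rewrite (bernstein_affine n (fun k => (k%:R - n%:R * x) ^+ 2)) bernstein_variance.
rewrite subrr expr0n add0r.
have h1 : x * (1 - x) <= 1 by nra.
have h2 : 0 <= 2 * K / d ^+ 2 * M ^+ 2.
  by rewrite !mulr_ge0// ?invr_ge0 ltW.
have -> : c * (n%:R * x * (1 - x)) = 2 * K / d ^+ 2 * M ^+ 2 * n%:R^-1 * (x * (1 - x)).
  by rewrite /c; field; rewrite !gt_eqF.
rewrite [leRHS](splitr e) lerD2l; move: hN; set Q := 2 * K / d ^+ 2 * M ^+ 2 in h2 *.
have ni : 0 < n%:R^-1 :> R by rewrite invr_gt0.
rewrite -/n ltr_pdivlMr ?ltr_wpDl// => hN.
apply: (@le_trans _ _ (Q * n%:R^-1)).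
  by rewrite ler_piMr// mulr_ge0// ltW.
by apply: le_trans (ltW hN); rewrite mulrDr mulr1 mulrC lerDl ltW.
Qed.

End Weierstrass.

(** * Positive operators, absolute values and the mixed Schwarz inequality *)

Section PositiveOperators.
Context {R : realType} {V : hilbertType R}.
Implicit Types (A T : V -> V) (f g : R -> R).

Definition positive_op A :=
  [/\ bounded_op A, selfadj A & forall x, 0 <= rdot (A x) x].

Lemma positive_bop A : positive_op A -> bounded_op A.
Proof. by case. Qed.

Lemma positive_spectrum A t : positive_op A -> spectrum A t%:C ->
  0 <= t <= opnorm A.
Proof.
move=> [bA sA pA] st; rewrite (spectrum_ge0 bA sA pA st) /=.
exact: (spectrum_le bA sA (le_opnorm bA) st).
Qed.

Lemma positive_approximable A B f : positive_op A -> positive_op B ->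
  {within `[0, +oo[, continuous f} ->
  approximable [set t | spectrum A t%:C \/ spectrum B t%:C] f.
Proof.
move=> pA pB fc e e0.
have nA : 0 <= opnorm A by case: pA => /opnorm_ge0.
have nB : 0 <= opnorm B by case: pB => /opnorm_ge0.
have M0 : 0 < opnorm A + opnorm B + 1 by lra.
have [p hp] := weierstrass M0 fc e0; exists p => t [] st; apply: hp => /=.
  by have := positive_spectrum pA st; lra.
by have := positive_spectrum pB st; lra.
Qed.

Lemma positive_cfc A f : positive_op A -> {within `[0, +oo[, continuous f} ->
  fcalc A f (cfc f A).
Proof.
move=> pA fc; have [bA sA _] := pA; apply: cfc_fcalc => // e e0.
have [p hp] := positive_approximable pA pA fc e0.
by exists p => t st; apply: hp; left.
Qed.

Lemma positive_spectrum_bound A f : positive_op A ->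
  {within `[0, +oo[, continuous f} ->
  exists2 K : R, 0 <= K & forall t, spectrum A t%:C -> `|f t| <= K.
Proof.
move=> pA fc.
have [K K0 hK] := segment_bounded (opnorm_ge0 (positive_bop pA)) fc.
by exists K => // t st; apply: hK; exact: positive_spectrum.
Qed.

Lemma positive_fcalc A f S : positive_op A -> {within `[0, +oo[, continuous f} ->
  (forall t : R, 0 <= t -> 0 <= f t) -> fcalc A f S -> positive_op S.
Proof.
move=> pA fc f0 fS; have [bA sA _] := pA; split.
- exact: fcalc_bop fS.
- exact: fcalc_selfadj fS.
have [K K0 hK] := positive_spectrum_bound pA fc.
apply: (fcalc_ge0 (K := K) bA sA fS) => t st.
have /andP[t0 _] := positive_spectrum pA st.
by rewrite f0//=; apply: le_trans (hK _ st); exact: ler_norm.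
Qed.

Lemma positive_adj_comp T : bounded_op T -> positive_op (adjoint T \o T).
Proof.
move=> bT; split.
- exact: bop_comp (bop_adjoint bT) bT.
- by move=> x y /=; rewrite -(adjointE bT) rdotC -(adjointE bT) rdotC.
- by move=> x /=; rewrite rdotC -(adjointE bT) rdotxx sqr_ge0.
Qed.

Lemma within_sqrt : {within `[0 : R, +oo[, continuous (@Num.sqrt R)}.
Proof. by apply: continuous_subspaceT => x; exact: sqrt_continuous. Qed.

Lemma absop_fcalc T : bounded_op T ->
  fcalc (adjoint T \o T) (@Num.sqrt R) (absop T).
Proof.
by move=> bT; exact: positive_cfc (positive_adj_comp bT) within_sqrt.
Qed.

Lemma positive_absop T : bounded_op T -> positive_op (absop T).
Proof.
move=> bT; apply: positive_fcalc (positive_adj_comp bT) within_sqrt _ (absop_fcalc bT).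
by move=> t _; exact: sqrtr_ge0.
Qed.

Lemma absop_sqr T : bounded_op T -> sqop (absop T) = adjoint T \o T.
Proof.
move=> bT; have pA := positive_adj_comp bT; have [bA sA _] := pA.
have [K K0 hK] := positive_spectrum_bound pA within_sqrt.
have fT := absop_fcalc bT.
apply: (fcalc_uniq bA sA (fcalc_mul bA sA fT fT hK hK K0) (fcalc_id bA)) => t st.
by have /andP[t0 _] := positive_spectrum pA st; rewrite -expr2 sqr_sqrtr.
Qed.

(** [T (T^* T) = (T T^* ) T] passes first to the square roots and then to any
    continuous function of them. *)
Lemma absop_intertwine T f : bounded_op T -> {within `[0, +oo[, continuous f} ->
  forall x, T (cfc f (absop T) x) = cfc f (absop (adjoint T)) (T x).
Proof.
move=> bT fc; have bT' := bop_adjoint bT.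
have pA := positive_adj_comp bT; have pB := positive_adj_comp bT'.
have pP := positive_absop bT; have pQ := positive_absop bT'.
have [bA sA _] := pA; have [bB sB _] := pB.
have [bP sP _] := pP; have [bQ sQ _] := pQ.
apply: (fcalc_intertwine bP sP bQ sQ bT _ (positive_approximable pP pQ fc)
  (positive_cfc pP fc) (positive_cfc pQ fc)).
apply: (fcalc_intertwine bA sA bB sB bT _ (positive_approximable pA pB within_sqrt)
  (absop_fcalc bT) (absop_fcalc bT')) => x /=.
by rewrite adjointK.
Qed.

(** With [h = 1 / (f + e)] and [|T| = P], [|T^*| = Q] one has
    [<Tx, y> = <T h(P) (f + e)(P) x, y> = <(f + e)(P) x, T^* h(Q) y>], and
    [|T^* h(Q) y| = |Q h(Q) y| <= |g(Q) y|] because [t h(t) <= g(t)].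
    Letting [e] tend to [0] replaces the polar decomposition of [T]. *)
Lemma mixed_schwarz T f g : bounded_op T ->
  {within `[0, +oo[, continuous f} -> {within `[0, +oo[, continuous g} ->
  (forall t : R, 0 <= t -> 0 <= f t) -> (forall t : R, 0 <= t -> 0 <= g t) ->
  (forall t : R, 0 <= t -> f t * g t = t) ->
  forall x y, rdot (T x) y <=
    rnorm (cfc f (absop T) x) * rnorm (cfc g (absop (adjoint T)) y).
Proof.
move=> bT fc gc f0 g0 fg x y; have bT' := bop_adjoint bT.
have pP := positive_absop bT; have pQ := positive_absop bT'.
have [bP sP _] := pP; have [bQ sQ _] := pQ.
set P := absop T in pP bP sP *; set Q := absop (adjoint T) in pQ bQ sQ *.
have fF := positive_cfc pP fc; have fG := positive_cfc pQ gc.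
set F := cfc f P in fF *; set G := cfc g Q in fG *.
apply: (@le_epsilon_mul _ _ _ (rnorm x * rnorm (G y))).
  by rewrite mulr_ge0// rnorm_ge0.
move=> e e0; pose h (t : R) := (f t + e)^-1.
have fe (t : R) : 0 <= t -> 0 < f t + e by move=> t0; rewrite ltr_wpDl// f0.
have hc : {within `[0, +oo[, continuous h}.
  rewrite continuous_subspace_in => t; rewrite inE /= in_itv /= andbT => t0.
  apply: cvgV; first by rewrite gt_eqF// fe.
  by apply: cvgD; [exact: fc | exact: cvg_cst].
have fhP := positive_cfc pP hc; have fhQ := positive_cfc pQ hc.
set hP := cfc h P in fhP; set hQ := cfc h Q in fhQ.
have ThP z : T (hP z) = hQ (T z) by exact: absop_intertwine.
pose Fe z := F z + e%:C *: (1%:C *: z).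
have fFe : fcalc P (fun t => f t + e * 1) Fe := fcalc_lin e fF (fcalc_scalar P 1).
(* [hP] inverts [Fe], as [h * (f + e) = 1] *)
have hFe : hP (Fe x) = x.
  have [K K0 hK] := positive_spectrum_bound pP hc.
  have [L L0 hL] := positive_spectrum_bound pP fc.
  have KL t : spectrum P t%:C -> `|h t| <= K + (L + e).
    by move=> /hK h1; lra.
  have LK t : spectrum P t%:C -> `|f t + e * 1| <= K + (L + e).
    move=> /hL h1; apply: le_trans (ler_normD _ _) _.
    by rewrite mulr1 (gtr0_norm e0); lra.
  have KL0 : 0 <= K + (L + e) by lra.
  have := fcalc_mul bP sP fhP fFe KL LK KL0.
  move=> /(fcalc_uniq bP sP)/(_ (fcalc_scalar P 1)) H.
  have -> : hP (Fe x) = (hP \o Fe) x by [].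
  rewrite H ?scale1r// => t st; rewrite mulr1 /h mulVf// gt_eqF// fe//.
  by have /andP[] := positive_spectrum pP st.
have bhQ := fcalc_bop bQ fhQ; have shQ := fcalc_selfadj sQ fhQ.
have -> : rdot (T x) y = rdot (Fe x) (adjoint T (hQ y)).
  by rewrite -{1}hFe ThP shQ (adjointE bT).
have TQ : rnorm (adjoint T (hQ y)) = rnorm (Q (hQ y)).
  apply/eqP; rewrite -(@eqrXn2 _ 2) ?rnorm_ge0// -!rdotxx; apply/eqP.
  have QQ z : Q (Q z) = adjoint (adjoint T) (adjoint T z).
    exact: (congr1 (fun S => S z) (absop_sqr bT')).
  by rewrite sQ QQ (adjointE bT').
have Qh : rnorm (Q (hQ y)) <= rnorm (G y).
  have [K K0 hK] := positive_spectrum_bound pQ hc.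
  have [L L0 hL] := positive_spectrum_bound pQ gc.
  have idc : {within `[0 : R, +oo[, continuous id}.
    by apply: continuous_subspaceT => t; exact: cvg_id.
  have [N N0 hN] := positive_spectrum_bound pQ idc.
  have KN t : spectrum Q t%:C -> `|h t| <= K + N by move=> /hK; lra.
  have NK t : spectrum Q t%:C -> `|t| <= K + N by move=> /hN; lra.
  have KN0 : 0 <= K + N by lra.
  have fQh := fcalc_mul bQ sQ (fcalc_id bQ) fhQ NK KN KN0.
  apply: (fcalc_dominated bQ sQ fQh fG (K := L)) => t st.
  have /andP[t0 _] := positive_spectrum pQ st.
  rewrite (hL _ st) andbT (ger0_norm (g0 _ t0)) ger0_norm /h.
    rewrite ler_pdivrMr ?fe// -{1}(fg t t0) mulrC ler_wpM2l ?g0//.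
    by rewrite lerDl ltW.
  by rewrite divr_ge0// ltW// fe.
apply: le_trans (rdot_le _ _) _; rewrite TQ.
apply: (@le_trans _ _ (rnorm (Fe x) * rnorm (G y))).
  by rewrite ler_wpM2l// rnorm_ge0.
rewrite mulrA -mulrDl ler_wpM2r ?rnorm_ge0//.
apply: le_trans (rnormD _ _) _.
by rewrite scale1r rnormZ gtr0_norm.
Qed.

Lemma mixed_schwarz_hdot T f g : bounded_op T ->
  {within `[0, +oo[, continuous f} -> {within `[0, +oo[, continuous g} ->
  (forall t : R, 0 <= t -> 0 <= f t) -> (forall t : R, 0 <= t -> 0 <= g t) ->
  (forall t : R, 0 <= t -> f t * g t = t) ->
  forall x y, rnorm (hdot (T x) y : R[i]) <=
    rnorm (cfc f (absop T) x) * rnorm (cfc g (absop (adjoint T)) y).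
Proof.
move=> bT fc gc f0 g0 fg x y; apply: hdot_le; first exact: bopZ.
move=> c c1; apply: le_trans (mixed_schwarz bT fc gc f0 g0 fg _ _) _.
have bF := fcalc_bop (positive_bop (positive_absop bT))
  (positive_cfc (positive_absop bT) fc).
by rewrite (bopZ bF) rnormZC c1 mul1r.
Qed.

Lemma selfadj_le_sqrt_opnorm (F : V -> V) : bounded_op F -> selfadj F ->
  forall x, rnorm (F x) <= Num.sqrt (opnorm (sqop F)) * rnorm x.
Proof.
move=> bF sF x; have bFF := bop_comp bF bF.
rewrite -(@ler_pXn2r _ 2)// ?nnegrE ?mulr_ge0 ?rnorm_ge0 ?sqrtr_ge0//.
rewrite exprMn sqr_sqrtr ?opnorm_ge0// -rdotxx sF.
apply: le_trans (rdot_le _ _) _; rewrite mulrC expr2 mulrA ler_wpM2r ?rnorm_ge0//.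
exact: (le_opnorm bFF).
Qed.

End PositiveOperators.

(** * Operator matrices and pencils *)

Section OperatorMatrices.
Context {R : realType}.

Lemma rnorm_hsum (W : hilbertType R) n (x : hsum W n) :
  rnorm x ^+ 2 = \sum_(i < n) rnorm (x i) ^+ 2.
Proof.
rewrite -rdotxx /rdot (_ : hdot x x = \sum_(i < n) hdot (x i) (x i))//.
rewrite (big_morph _ (@ReD R) (erefl _)).
by apply: eq_bigr => i _; rewrite -rdotxx.
Qed.

Lemma rnorm_coord (W : hilbertType R) n (x : hsum W n) i : rnorm (x i) <= rnorm x.
Proof. by have := hsum_norm_coord x i; rewrite !normE lecR. Qed.

Lemma bop_opmx (W : hilbertType R) n (T : 'I_n -> 'I_n -> W -> W) :
  (forall i j, bounded_op (T i j)) -> bounded_op (opmx T).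
Proof.
move=> bT; have [c hc] : {c : 'I_n * 'I_n -> R &
    forall ij, 0 <= c ij /\ forall x, rnorm (T ij.1 ij.2 x) <= c ij * rnorm x}.
  apply: (choice (P := fun ij c => 0 <= c /\
    forall x, rnorm (T ij.1 ij.2 x) <= c * rnorm x)) => ij.
  by have [c c0 h] := bop_bound (bT ij.1 ij.2); exists c.
apply: (bop_intro (c := \sum_(i < n) \sum_(j < n) c (i, j))) => [a x y|x].
  apply/ffunP => i; rewrite !ffunE scaler_sumr -big_split /=.
  by apply: eq_bigr => j _; rewrite !ffunE (bopD (bT i j)) (bopZ (bT i j)).
have h1 : rnorm (opmx T x) <= \sum_(i < n) rnorm (opmx T x i).
  have := hsum_norm_sum (opmx T x); rewrite normE.
  under eq_bigr do rewrite normE.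
  by rewrite -rmorph_sum lecR.
apply: le_trans h1 _; rewrite mulr_suml; apply: ler_sum => i _.
rewrite ffunE mulr_suml; apply: le_trans (rnorm_sum _) _; apply: ler_sum => j _.
have [c0 h] := hc (i, j); apply: le_trans (h _) _.
by rewrite ler_wpM2l// rnorm_coord.
Qed.

Lemma bop_mulC (a : R[i]) : @bounded_op R R[i] R[i] (fun z => a * z).
Proof.
apply: (bop_intro (c := complex.Re `|a|)) => [b x y|x].
  by rewrite mulrDr; congr (_ + _); exact: mulrCA.
by have := rnormZC a (x : R[i]) => ->.
Qed.

Lemma bop_mxop n (A : 'M[R[i]]_n) : bounded_op (mxop A).
Proof. by apply: bop_opmx => i j; exact: bop_mulC. Qed.

Lemma hdot_opmx (W : hilbertType R) n (T : 'I_n -> 'I_n -> W -> W) (x y : hsum W n) :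
  hdot (opmx T x) y = \sum_(i < n) \sum_(j < n) hdot (T i j (x j)) (y i).
Proof.
rewrite [LHS](_ : _ = \sum_(i < n) hdot (opmx T x i) (y i))//.
apply: eq_bigr => i _; rewrite ffunE.
by apply: (big_morph (fun u => hdot u (y i))) => [u v|];
  rewrite ?hdotDl// linear0l.
Qed.

(** The vector of the norms of the coordinates, on which scalar matrices of
    norm bounds act. *)
Definition profile (W : hilbertType R) n (x : hsum W n) : hsum R[i] n :=
  [ffun i => (rnorm (x i))%:C].

Lemma rnorm_profile (W : hilbertType R) n (x : hsum W n) :
  rnorm (profile x) = rnorm x.
Proof.
apply/eqP; rewrite -(@eqrXn2 _ 2) ?rnorm_ge0// !rnorm_hsum; apply/eqP.
apply: eq_bigr => i _; rewrite ffunE /rnorm normc_def /= expr0n addr0 sqrtr_sqr.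
by rewrite real_normK// num_real.
Qed.

Lemma rdot_mxop_profile (W : hilbertType R) n (m : 'I_n -> 'I_n -> R)
    (A : 'M[R[i]]_n) (x : hsum W n) : (forall i j, A i j = (m i j)%:C) ->
  rdot (mxop A (profile x)) (profile x) =
  \sum_(i < n) \sum_(j < n) m i j * (rnorm (x j) * rnorm (x i)).
Proof.
move=> Am; rewrite /rdot hdot_opmx (big_morph _ (@ReD R) (erefl _)).
apply: eq_bigr => i _; rewrite (big_morph _ (@ReD R) (erefl _)).
apply: eq_bigr => j _; rewrite !ffunE Am.
rewrite (_ : hdot _ _ = (m i j * (rnorm (x j) * rnorm (x i)))%:C)//.
rewrite [LHS](_ : _ = (m i j)%:C * (rnorm (x j))%:C * ((rnorm (x i))%:C)^*%R)//.
by rewrite conj_Creal ?complex_real// -!rmorphM mulrA.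
Qed.

(** Quadratic forms see only the symmetric part of a matrix. *)
Lemma sum_symmetrize n (a : 'I_n -> 'I_n -> R) (u : 'I_n -> R) :
  \sum_(i < n) \sum_(j < n) 2^-1 * (a i j + a j i) * (u j * u i) =
  \sum_(i < n) \sum_(j < n) a i j * (u j * u i).
Proof.
pose s := \sum_(i < n) \sum_(j < n) a i j * (u j * u i).
have s' : \sum_(i < n) \sum_(j < n) a j i * (u j * u i) = s.
  by rewrite exchange_big; do 2!apply: eq_bigr => ? _; rewrite (mulrC (u _)).
transitivity (2^-1 * (s + s)); last by rewrite -/s; lra.
rewrite -{2}s' -big_split mulr_sumr; apply: eq_bigr => i _.
by rewrite -big_split mulr_sumr; apply: eq_bigr => j _ /=; ring.
Qed.

Lemma rnorm_hdot_opmx_le (W : hilbertType R) n (T : 'I_n -> 'I_n -> W -> W)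
    (a : 'I_n -> 'I_n -> R) (x : hsum W n) :
  (forall i j, rnorm (hdot (T i j (x j)) (x i) : R[i]) <=
     a i j * (rnorm (x j) * rnorm (x i))) ->
  rnorm (hdot (opmx T x) x : R[i]) <=
  \sum_(i < n) \sum_(j < n) a i j * (rnorm (x j) * rnorm (x i)).
Proof.
move=> h; rewrite hdot_opmx.
apply: le_trans (rnorm_sum _) _; apply: ler_sum => i _.
by apply: le_trans (rnorm_sum _) _; apply: ler_sum => j _.
Qed.

Lemma hdot_opmx_le_matS (W : hilbertType R) n (T : 'I_n -> 'I_n -> W -> W)
    (x : hsum W n) : (forall i j, bounded_op (T i j)) ->
  rnorm (hdot (opmx T x) x : R[i]) <=
  rdot (mxop (matS T) (profile x)) (profile x).
Proof.
move=> bT; rewrite (rdot_mxop_profile (m := fun i j => opnorm (T i j))); last first.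
  by move=> i j; rewrite mxE.
apply: rnorm_hdot_opmx_le => i j.
apply: hdot_le; first exact: bopZ.
move=> c c1; apply: le_trans (rdot_le _ _) _.
rewrite mulrA ler_wpM2r ?rnorm_ge0//; apply: le_trans (le_opnorm (bT i j) _) _.
by rewrite rnormZC c1 mul1r.
Qed.

Lemma hdot_opmx_le_matR (W : hilbertType R) n (T : 'I_n -> 'I_n -> W -> W)
    (f g : R -> R) (x : hsum W n) : (forall i j, bounded_op (T i j)) ->
  {within `[0, +oo[, continuous f} -> {within `[0, +oo[, continuous g} ->
  (forall t : R, 0 <= t -> 0 <= f t) -> (forall t : R, 0 <= t -> 0 <= g t) ->
  (forall t : R, 0 <= t -> f t * g t = t) ->
  rnorm (hdot (opmx T x) x : R[i]) <=
  rdot (mxop (matR T f g) (profile x)) (profile x).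
Proof.
move=> bT fc gc f0 g0 fg.
pose nF i j := opnorm (sq_cfc_abs f (T i j)).
pose nG i j := opnorm (sq_cfc_abs g (adjoint (T i j))).
pose a i j := if i == j then
    2^-1 * opnorm (sq_cfc_abs f (T i i) \+ sq_cfc_abs g (adjoint (T i i)))
  else Num.sqrt (nF i j) * Num.sqrt (nG i j).
rewrite (rdot_mxop_profile (m := fun i j => 2^-1 * (a i j + a j i))); last first.
  move=> i j; rewrite mxE /a (eq_sym j i); case: eqP => [<-|//].
  by congr (_%:C); lra.
rewrite sum_symmetrize; apply: rnorm_hdot_opmx_le => i j.
have ms := mixed_schwarz_hdot (bT i j) fc gc f0 g0 fg (x j) (x i).
apply: le_trans ms _.
have bT' := bop_adjoint (bT i j).
have [bF sF _] : positive_op (cfc f (absop (T i j))).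
  by apply: positive_fcalc (positive_cfc _ fc) => //; exact: positive_absop.
have [bG sG _] : positive_op (cfc g (absop (adjoint (T i j)))).
  by apply: positive_fcalc (positive_cfc _ gc) => //; exact: positive_absop.
rewrite /a; case: eqP => [ij|_]; last first.
  have h1 := selfadj_le_sqrt_opnorm bF sF (x j).
  have h2 := selfadj_le_sqrt_opnorm bG sG (x i).
  by apply: le_trans (ler_pM _ _ h1 h2) _; rewrite ?rnorm_ge0// mulrACA.
(* on the diagonal, the arithmetic-geometric inequality *)
subst j; rewrite /sq_cfc_abs.
move: (cfc f _) (cfc g _) bF sF bG sG => F G bF sF bG sG.
have bFG : bounded_op (sqop F \+ sqop G).
  by apply: bop_add; exact: bop_comp.
have h : rnorm (F (x i)) ^+ 2 + rnorm (G (x i)) ^+ 2 =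
    rdot ((sqop F \+ sqop G) (x i)) (x i).
  by rewrite /= rdotDl /sqop /= sF sG !rdotxx.
have h1 := rdot_le ((sqop F \+ sqop G) (x i)) (x i).
have h2 := ler_wpM2r (rnorm_ge0 (x i)) (le_opnorm bFG (x i)).
rewrite -(mulrA (opnorm _)) in h2.
have h3 := sqr_ge0 (rnorm (F (x i)) - rnorm (G (x i))).
rewrite -mulrA ler_pdivlMl//; apply: le_trans h2; apply: le_trans h1; rewrite -h.
by rewrite -subr_ge0; apply: le_trans h3 _; rewrite le_eqVlt; apply/orP; left;
  apply/eqP; ring.
Qed.

End OperatorMatrices.

Section Pencil.
Context {R : realType} {V : hilbertType R}.
Implicit Types X Y : V -> V.

Definition pencil X Y (a : R) : V -> V := a%:C \*: X \+ (1 - a)%:C \*: Y.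

Lemma bop_pencil X Y a : bounded_op X -> bounded_op Y ->
  bounded_op (pencil X Y a).
Proof. by move=> bX bY; apply: bop_add; exact: bop_scale. Qed.

Lemma opnorm_pencil_lipschitz X Y a b : bounded_op X -> bounded_op Y ->
  opnorm (pencil X Y a) <= opnorm (pencil X Y b) + `|a - b| * opnorm (X \- Y).
Proof.
move=> bX bY; have bXY := bop_sub bX bY; apply: opnorm_le.
  by rewrite addr_ge0 ?mulr_ge0 ?opnorm_ge0//; exact: bop_pencil.
move=> x; have -> : pencil X Y a x = pencil X Y b x + (a - b)%:C *: (X \- Y) x.
  rewrite /pencil /= scalerBr -[RHS]addrACA -scalerDl -scalerBl -rmorphD -rmorphB.
  by congr (_%:C *: _ + _%:C *: _); ring.
apply: le_trans (rnormD _ _) _; rewrite mulrDl lerD//.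
  by apply: le_opnorm; exact: bop_pencil.
by rewrite rnormZ -mulrA ler_wpM2l//; exact: le_opnorm.
Qed.

Lemma continuous_opnorm_pencil X Y : bounded_op X -> bounded_op Y ->
  continuous (fun a => opnorm (pencil X Y a)).
Proof.
move=> bX bY a; have bXY := bop_sub bX bY; have K0 := opnorm_ge0 bXY.
set K := opnorm (X \- Y) in K0.
apply/cvgrPdist_le => e e0; have K1 : 0 < K + 1 by lra.
near=> b.
have h : `|a - b| <= e / (K + 1).
  by near: b; apply: cvgr_dist_le => //; rewrite divr_gt0.
have {}h : `|a - b| * K <= e.
  rewrite ler_pdivlMr// in h; apply: le_trans h.
  by rewrite ler_wpM2l// lerDl.
have h1 := opnorm_pencil_lipschitz a b bX bY.
have h2 := opnorm_pencil_lipschitz b a bX bY.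
rewrite (distrC b) in h2; rewrite -/K in h1 h2.
by rewrite ler_norml; apply/andP; split; lra.
Unshelve. all: by end_near. Qed.

End Pencil.

(** * The numerical radius inequality *)

Lemma square_pencil_form {R : realType} {V : hilbertType R} (A B : V -> V)
    (a : R) (x : V) : bounded_op A -> bounded_op B ->
  rdot (pencil (sqop (absop A)) (sqop (absop B)) a x) x =
  a * rnorm (A x) ^+ 2 + (1 - a) * rnorm (B x) ^+ 2.
Proof.
move=> bA bB; rewrite /pencil /= rdotDl !rdotZl !absop_sqr//=.
by rewrite !(rdotC (adjoint _ _)) -(adjointE bA) -(adjointE bB) !rdotxx.
Qed.

(** Each of the two operators dominates [w] at [x], hence [w ^ 2] is at most
    any convex combination of [|A x| ^ 2] and [|B x| ^ 2], which is a value of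
    the quadratic form of the pencil by [square_pencil_form]. *)
Lemma sqr_le_pencil {R : realType} {V : hilbertType R} (A B : V -> V)
    (a w : R) (x : V) : bounded_op A -> bounded_op B -> 0 <= a <= 1 ->
  rnorm x = 1 -> 0 <= w -> w <= rdot (A x) x -> w <= rdot (B x) x ->
  w <= Num.sqrt (opnorm (pencil (sqop (absop A)) (sqop (absop B)) a)).
Proof.
move=> bA bB /andP[a0 a1] x1 w0 wA wB.
have bS (C : V -> V) : bounded_op C -> bounded_op (sqop (absop C)).
  by move=> bC; have [bP _ _] := positive_absop bC; exact: bop_comp.
have bP := bop_pencil a (bS _ bA) (bS _ bB).
rewrite -(ger0_norm w0) -sqrtr_sqr ler_sqrt ?opnorm_ge0//.
have := rdot_le (pencil (sqop (absop A)) (sqop (absop B)) a x) x.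
have := le_opnorm bP x; rewrite square_pencil_form// x1 !mulr1 => h1 h2.
apply: le_trans (le_trans h2 h1).
have sq (C : V -> V) : w <= rdot (C x) x -> w ^+ 2 <= rnorm (C x) ^+ 2.
  move=> h; have := le_trans h (rdot_le _ _); rewrite x1 mulr1 => wC.
  by rewrite ler_pXn2r ?nnegrE ?rnorm_ge0.
have hA := ler_wpM2l a0 (sq _ wA).
have a1' : 0 <= 1 - a by lra.
have hB := ler_wpM2l a1' (sq _ wB).
lra.
Qed.

Unset Implicit Arguments.

Theorem corollary2p15 (R : realType) (H : hilbertType R) (n : nat)
    (T : 'I_n -> 'I_n -> H -> H)
    (T_bounded : forall i j, bounded_op (T i j))
    (f g : R -> R)
    (f_continuous : {within `[0, +oo[, continuous f})
    (g_continuous : {within `[0, +oo[, continuous g})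
    (f_ge0 : forall t : R, 0 <= t -> 0 <= f t)
    (g_ge0 : forall t : R, 0 <= t -> 0 <= g t)
    (fg_id : forall t : R, 0 <= t -> f t * g t = t) :
  exists m : R,
    is_minimum
      [set Num.sqrt (opnorm
             (alpha%:C \*: sqop (absop (mxop (matR T f g)))
              \+ (1 - alpha)%:C \*: sqop (absop (mxop (matS T)))))
        | alpha in `[0, 1]] m /\
    numradius (opmx T) <= m.
Proof.
pose A := mxop (matR T f g); pose B := mxop (matS T).
have bA : bounded_op A := bop_mxop _; have bB : bounded_op B := bop_mxop _.
pose X := sqop (absop A); pose Y := sqop (absop B).
have bX : bounded_op X by have [bP _ _] := positive_absop bA; exact: bop_comp.
have bY : bounded_op Y by have [bP _ _] := positive_absop bB; exact: bop_comp.
pose phi (a : R) := Num.sqrt (opnorm (pencil X Y a)).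
have phi_cont : continuous phi.
  move=> a; apply: (@continuous_comp _ _ _ (fun a => opnorm (pencil X Y a)) Num.sqrt).
    by exact: continuous_opnorm_pencil.
  exact: sqrt_continuous.
have phiW : {within `[0, 1], continuous phi} by exact: continuous_subspaceT.
have [a a01 amin] := EVT_min ler01 phiW.
exists (phi a); split.
  split; first by exists a.
  by move=> _ [b b01 <-]; exact: amin.
have bound x : `|x| = 1 -> rnorm (hdot (opmx T x) x) <= phi a.
  move=> x1; have x1' : rnorm (profile x) = 1.
    by rewrite rnorm_profile /rnorm x1.
  apply: (sqr_le_pencil bA bB _ x1').
  - by move: a01; rewrite in_itv.
  - exact: rnorm_ge0.
  - exact: hdot_opmx_le_matR.
  - exact: hdot_opmx_le_matS.
have [[x x1]|/forallNP nox] := pselect (exists x : hsum H n, `|x| = 1).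
  apply: ge_sup; first by exists (rnorm (hdot (opmx T x) x)); exists x.
  by move=> _ [y y1 <-]; exact: bound.
have -> : numradius (opmx T) = sup set0.
  congr sup; apply/seteqP; split=> // y [x x1 _]; case: (nox x x1).
by rewrite sup0 sqrtr_ge0.
Qed.
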